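(* Let $\alpha$ be a composition of $n$ and $\mathscr E:=D(X_\alpha,\mathrm w_{RB})$. Then $$\mathsf B\big([\,w_0(\mathrm{set}(\mathsf r(\mathscr E))),\ w_1(\mathrm{set}(\mathsf r(\mathscr E)))\,]_L\big)$$ is an injective hull of $X_\alpha$. In particular, it is a projective indecomposable module.
   Context: Permutations. $n$ is a positive integer, $[n]=\{1,\dots,n\}$, $\mathfrak S_n$ the symmetric group (product = composition of maps; permutations written as words), $s_i=(i,i+1)$, $\ell(\sigma)$ Coxeter length, $w_0$ the longest element. $\mathrm{Des}_L(\sigma)=\{i:\ell(s_i\sigma)<\ell(\sigma)\}$, $\mathrm{Des}_R(\sigma)=\{i:\ell(\sigma s_i)<\ell(\sigma)\}$. $\preceq_L$ has covers $\sigma\prec s_i\sigma$, $i\notin\mathrm{Des}_L(\sigma)$; $[\sigma,\rho]_L$ is the interval for $\preceq_L$. For $S\subseteq[n-1]$, $S^{c}=[n-1]\setminus S$; $w_0(S)$ is the longest element of the subgroup generated by $\{s_i:i\in S\}$; $w_1(S)=w_0w_0(S^c)$ is the longest element of $\{z:\mathrm{Des}_R(z)\subseteq S\}$. For a composition $\alpha=(\alpha_1,\dots,\alpha_l)$ of $n$, $\ell(\alpha)=l$ and $\mathrm{set}(\alpha)=\{\alpha_1,\dots,\alpha_1+\dots+\alpha_{l-1}\}$. Modules. $H_n(0)$ is the unital associative $\mathbb C$-algebra generated by $\pi_1,\dots,\pi_{n-1}$ with $\pi_i^2=\pi_i$, $\pi_i\pi_{i+1}\pi_i=\pi_{i+1}\pi_i\pi_{i+1}$,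 $\pi_i\pi_j=\pi_j\pi_i$ for $|i-j|\ge2$. For a nonempty left weak Bruhat interval $I$, $\mathsf B(I)$ is the left $H_n(0)$-module with basis $I$ and $\pi_i\cdot\gamma=\gamma$ if $i\in\mathrm{Des}_L(\gamma)$; $=0$ if $i\notin\mathrm{Des}_L(\gamma)$, $s_i\gamma\notin I$; $=s_i\gamma$ if $i\notin\mathrm{Des}_L(\gamma)$, $s_i\gamma\in I$. Injective hulls are in the category of finitely generated left $H_n(0)$-modules. Diagrams and tableaux. Boxes are $(x,y)$ with $x$ = column from the left, $y$ = row from the bottom. $\mathrm{tcd}(\alpha)=\{(j,i):1\le i\le\ell(\alpha),1\le j\le\alpha_i\}$. $D(X_\alpha,\mathrm w_{RB})=\{(j,i):(i,j)\in\mathrm{tcd}(\alpha)\}$. For a diagram $D$, $\mathsf r(D)$ is the composition listing the numbers of boxes in its rows from top to bottom. The module $X_\alpha$ is Searles's $H_n(0)$-module with basis the standard extended tableaux of shape $\alpha$ (bijective fillings of $\mathrm{tcd}(\alpha)$ by $[n]$ with rows increasing left to right and all columns increasing bottom to top), whose quasisymmetric characteristic is the extended Schur function. It is known that $X_\alpha\cong\mathsf B([w_0(\mathrm{set}(\alpha)^c),\mathrm w_{RB}(\mathsf T'_\alpha)]_L)$, and this may be taken as its definition up to isomorphism; here $\mathsf T'_\alpha$ is the standard extended tableau filled with $1,\dots,n$ up each column (bottom to top), leftmost column first, and $\mathrm w_{RB}$ reads each row right to left, bottom row first. *)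

(* Defs.v *)
From HB Require Import structures.
From mathcomp Require Import all_boot all_order all_algebra all_fingroup.
From mathcomp Require Import generic_quotient boolp zify.

Set Implicit Arguments.
Unset Strict Implicit.
Unset Printing Implicit Defensive.

Import GRing.Theory.

(* Conventions.  'S_n permutes {0, ..., n-1}; the letter k of [n] = {1, ..., n}
   is the ordinal k - 1, and likewise the index k of [n-1] is k - 1 : 'I_n.-1.
   Boxes of diagrams keep their 1-based coordinates (column, row). *)

Section Permutations.

Variable n : nat.
Implicit Types (i j : 'I_n.-1) (s t x y z : 'S_n) (S : {set 'I_n.-1}).

(* Composition of maps: (s * t)%g in MathComp applies s first. *)
Definition pmul s t : 'S_n := (t * s)%g.

Fact hi_subproof i : (i.+1 < n)%N.
Proof. by rewrite -ltn_predRL. Qed.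

Definition lo i : 'I_n := widen_ord (leq_pred n) i.
Definition hi i : 'I_n := Ordinal (hi_subproof i).

Definition sgen i : 'S_n := tperm (lo i) (hi i).

Definition is_word_prod s (k : nat) : bool :=
  [exists w : k.-tuple 'I_n.-1, s == \big[pmul/1%g]_(i <- w) sgen i].

(* Inversions serve only to prove that the s_i generate and to compute descents. *)
Definition invset y : {set 'I_n * 'I_n} :=
  [set p : 'I_n * 'I_n | (p.1 < p.2)%N && (y p.2 < y p.1)%N].
Definition ninv y := #|invset y|.

Lemma lo_neq_hi i : lo i != hi i.
Proof. by rewrite -val_eqE /= neq_ltn leqnn. Qed.

Lemma val_sgen i (a : 'I_n) :
  nat_of_ord (sgen i a) =
  if a == i :> nat then i.+1 else if a == i.+1 :> nat then i : nat else a.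
Proof.
rewrite /sgen; case: tpermP => [->|->|/eqP h1 /eqP h2] /=.
- by rewrite eqxx.
- by rewrite eqn_leq ltnn /= eqxx.
by move: h1 h2; rewrite -!val_eqE /= => /negPf-> /negPf->.
Qed.

Lemma sgen_ltn i (a b : 'I_n) : (a < b)%N -> (a, b) != (lo i, hi i) ->
  (sgen i a < sgen i b)%N.
Proof.
move=> ab; rewrite xpair_eqE -!val_eqE /= !val_sgen.
by do 4?case: eqP; lia.
Qed.

Lemma sgenK i : involutive (sgen i).
Proof. exact: tpermK. Qed.

Lemma ninv_up i y : (y (lo i) < y (hi i))%N -> ninv (sgen i * y)%g = (ninv y).+1.
Proof.
move=> yi; pose f (p : 'I_n * 'I_n) := (sgen i p.1, sgen i p.2).
have fK : involutive f by case=> a b; rewrite /f /= !sgenK.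
suff -> : ninv (sgen i * y)%g = #|(lo i, hi i) |: f @: invset y|.
  rewrite cardsU1 card_imset; last exact: inv_inj fK.
  rewrite [X in X + _](_ : _ = 1%N) //; apply/eqP; rewrite eqb1; apply/imsetP.
  case=> -[a b]; rewrite inE /= => /andP[ab _] [ea eb].
  move: ab; rewrite -(sgenK i a) -(sgenK i b) -ea -eb.
  by rewrite /sgen tpermL tpermR /= ltnNge leqnSn.
congr #|pred_of_set _|; apply/setP=> -[a b].
rewrite !inE /= !permM; have [[-> ->]|nab] := eqVneq (a, b) (lo i, hi i).
  by rewrite /sgen tpermL tpermR yi /= ltnSn.
apply/andP/imsetP => /= [[ab yab]|[[c d]]].
  exists (f (a, b)); last by rewrite fK.
  by rewrite inE /= yab sgen_ltn.
rewrite inE /= => /andP[cd ydc] [-> ->]; rewrite !sgenK ydc sgen_ltn //.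
by apply: contraTneq ydc => -[-> ->]; rewrite -leqNgt ltnW.
Qed.

Lemma ninv_step i y : ninv (sgen i * y)%g =
  if (y (hi i) < y (lo i))%N then (ninv y).-1 else (ninv y).+1.
Proof.
case: ltngtP => [yi|yi|/val_inj/perm_inj/eqP]; last 2 first.
- exact: ninv_up.
- by rewrite eq_sym (negPf (lo_neq_hi i)).
have := @ninv_up i (sgen i * y)%g; rewrite -{3}[sgen i]tpermV mulKg => -> //.
by rewrite !permM /sgen tpermL tpermR.
Qed.

Lemma ninv_gt0 i y : (y (hi i) < y (lo i))%N -> (0 < ninv y)%N.
Proof.
by move=> yi; rewrite card_gt0; apply/set0Pn; exists (lo i, hi i); rewrite inE yi /= ltnSn.
Qed.

Lemma ninv1 : ninv 1%g = 0.
Proof.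
apply/eqP; rewrite cards_eq0 -subset0; apply/subsetP=> -[a b].
by rewrite !inE !perm1 /= => /andP[ab ba]; lia.
Qed.

Lemma descent_ex y : y != 1%g -> exists i, (y (hi i) < y (lo i))%N.
Proof.
move=> y1; apply/existsP; apply: contraR y1 => /existsPn yi.
have ge (a : 'I_n) : (a <= y a)%N.
  case: a => m; elim: m => //= m IHm lm.
  have lm' : (m < n.-1)%N by lia.
  have := yi (Ordinal lm'); rewrite -leqNgt leq_eqVlt => /orP[/eqP/val_inj/perm_inj|].
    by move/eqP; rewrite (negPf (lo_neq_hi _)).
  rewrite (_ : hi _ = Ordinal lm); last exact: val_inj.
  apply: leq_ltn_trans; apply: leq_trans (IHm (ltnW lm)) _.
  by rewrite (_ : lo _ = Ordinal (ltnW lm)) //; exact: val_inj.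
have /leqif_sum : forall a : 'I_n, true -> (a <= y a ?= iff (a == y a :> nat))%N.
  by move=> a _; split; [exact: ge | ].
move=> /= [_]; rewrite [X in X == _](reindex_inj (@perm_inj _ y)) /= eqxx.
move/esym/forallP => e; apply/eqP/permP=> a.
by rewrite perm1; apply/esym/eqP; have := e a; rewrite -val_eqE.
Qed.

Lemma word_prod_ninv s k : is_word_prod s k -> (ninv s^-1%g <= k)%N.
Proof.
case/existsP=> -[w /= /eqP <-] /eqP->; elim: w => [|i w IHw] /=.
  by rewrite big_nil invg1 ninv1.
rewrite big_cons {1}/pmul invMg tpermV ninv_step; case: ifP => _ //.
by apply: leq_trans (leq_pred _) _; apply: leq_trans IHw _.
Qed.

Lemma ninv_word_prod s : is_word_prod s (ninv s^-1%g).
Proof.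
have [m] := ubnP (ninv s^-1%g); elim: m s => // m IHm s lm.
have [->|s1] := eqVneq s 1%g.
  by apply/existsP; rewrite invg1 ninv1; exists [tuple]; rewrite big_nil.
have /descent_ex[i yi] : (s^-1 != 1)%g by rewrite invg_eq1.
have ni := ninv_gt0 yi; have e : ninv (pmul (sgen i) s)^-1%g = (ninv s^-1%g).-1.
  by rewrite /pmul invMg tpermV ninv_step yi.
have /IHm/existsP[w /eqP ws] : (ninv (pmul (sgen i) s)^-1%g < m)%N by rewrite e -ltnS prednK.
rewrite -(prednK ni) -e; apply/existsP; exists [tuple of i :: w].
by rewrite big_cons -ws /pmul -mulgA tperm2 mulg1.
Qed.

Fact len_subproof s : exists k, is_word_prod s k.
Proof. by exists (ninv s^-1%g); exact: ninv_word_prod. Qed.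

(* Coxeter length: least number of letters of an expression of s in the s_i. *)
Definition len s : nat := ex_minn (len_subproof s).

Lemma lenE s : len s = ninv s^-1%g.
Proof.
rewrite /len; case: ex_minnP => k sk mk; apply/eqP.
by rewrite eqn_leq mk ?ninv_word_prod ?word_prod_ninv.
Qed.

Definition desL s : {set 'I_n.-1} := [set i | (len (pmul (sgen i) s) < len s)%N].

Lemma mem_desL i s : (i \in desL s) = (s^-1%g (hi i) < s^-1%g (lo i))%N.
Proof.
rewrite inE !lenE /pmul invMg tpermV ninv_step; case: ifPn => [/ninv_gt0 h|_].
  by rewrite ltn_predL.
by rewrite ltnNge leqnSn.
Qed.

Definition coverL s t : bool := [exists i, (i \notin desL s) && (t == pmul (sgen i) s)].
Definition leL s t : bool := connect coverL s t.
Definition intervalL s t : {set 'S_n} := [set z | leL s z && leL z t].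

Definition longest (A : {set 'S_n}) : 'S_n := [arg max_(z > 1%g in A) len z]%N.
Definition w0 : 'S_n := longest [set: 'S_n].
Definition w0S S : 'S_n := longest <<[set sgen i | i in S]>>%g.
Definition w1S S : 'S_n := pmul w0 (w0S (~: S)).

(* The 0-Hecke monoid acting on 'S_n, used to check the relations below. *)
Definition demz i s := if i \in desL s then s else pmul (sgen i) s.

Lemma leL_demz i s : leL s (demz i s).
Proof.
rewrite /demz; case: ifPn => [_|si]; first exact: connect0.
by apply: connect1; apply/existsP; exists i; rewrite si eqxx.
Qed.

Definition srt (a b : 'I_n) y : 'S_n := if (y b < y a)%N then y else (tperm a b * y)%g.

Lemma demzV i s : (demz i s)^-1%g = srt (lo i) (hi i) s^-1%g.
Proof. by rewrite /demz /srt mem_desL; case: ifP => // _; rewrite invMg tpermV. Qed.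

Lemma srt_idem a b y : a != b -> srt a b (srt a b y) = srt a b y.
Proof.
move=> ab; rewrite {2 3}/srt; case: ifPn => [h|h]; rewrite /srt ?h //.
rewrite !permM tpermL tpermR; case: ltngtP h => // /val_inj/perm_inj/eqP.
by rewrite eq_sym (negPf ab).
Qed.

Lemma srt_comm a b c d y : uniq [:: a; b; c; d] ->
  srt a b (srt c d y) = srt c d (srt a b y).
Proof.
rewrite /= !inE !negb_or -!andbA => /and5P[ab ac ad bc] /and3P[bd cd _].
have [ba ca da] : [/\ b != a, c != a & d != a] by rewrite ![_ == a]eq_sym.
have [cb db] : c != b /\ d != b by rewrite ![_ == b]eq_sym.
have comm : (tperm a b * (tperm c d * y) = tperm c d * (tperm a b * y))%g.
  rewrite !mulgA; congr (_ * y)%g.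
  by rewrite [LHS]conjgC tpermJ (tpermD ca da) (tpermD cb db).
have [h1|/negPf h1] := boolP (y b < y a)%N;
have [h2|/negPf h2] := boolP (y d < y c)%N;
  rewrite /srt ?(h1, h2) ?permM ?(tpermD ac bc) ?(tpermD ad bd);
  by rewrite ?(tpermD ca da) ?(tpermD cb db) ?(h1, h2).
Qed.

Lemma srt_braid a b c y : uniq [:: a; b; c] ->
  srt a b (srt b c (srt a b y)) = srt b c (srt a b (srt b c y)).
Proof.
rewrite /= !inE !negb_or -!andbA => /and4P[ab ac bc _].
have [ba ca cb] : [/\ b != a, c != a & c != b] by rewrite eq_sym ab eq_sym ac eq_sym bc.
have val_neq (u v : 'I_n) : u != v -> nat_of_ord (y u) <> nat_of_ord (y v).
  by move=> uv /val_inj/perm_inj/eqP; apply/negP.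
have := (val_neq _ _ ab, val_neq _ _ ac, val_neq _ _ bc) => -[[yab yac] ybc].
have tabE : (tperm a b a = b) * (tperm a b b = a) * (tperm a b c = c).
  by rewrite tpermL tpermR tpermD.
have tbcE : (tperm b c a = a) * (tperm b c b = c) * (tperm b c c = b).
  by rewrite tpermL tpermR tpermD.
have braid : (tperm a b * (tperm b c * (tperm a b * y)) =
              tperm b c * (tperm a b * (tperm b c * y)))%g.
  rewrite !mulgA; congr (_ * y)%g; apply/permP => x; rewrite !permM.
  case: (tpermP a b x) => [->|->|xa xb]; rewrite ?tabE ?tbcE ?tabE ?tbcE //.
  have [->|xc] := eqVneq x c; first by rewrite ?tabE ?tbcE ?tabE ?tbcE.
  have [ax bx] : a != x /\ b != x by split; apply/eqP => /esym.
  by move: xc; rewrite eq_sym => cx; rewrite !tpermD.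
have r1 : (y a < y b)%N = ~~ (y b < y a)%N by lia.
have r2 : (y b < y c)%N = ~~ (y c < y b)%N by lia.
have r3 : (y a < y c)%N = ~~ (y c < y a)%N by lia.
rewrite /srt.
have [h1|/negPf h1] := boolP (y b < y a)%N;
have [h2|/negPf h2] := boolP (y c < y b)%N;
have [h3|/negPf h3] := boolP (y c < y a)%N; try lia;
  by do 6!rewrite ?(r1, r2, r3, h1, h2, h3, permM, tabE, tbcE) /=.
Qed.

End Permutations.

Definition is_composition (n : nat) (alpha : seq nat) : bool :=
  all (leq 1) alpha && (sumn alpha == n).

(* i.+1 is a proper nonempty partial sum of alpha. *)
Definition compset (n : nat) (alpha : seq nat) : {set 'I_n.-1} :=
  [set i : 'I_n.-1 |
    [exists k : 'I_(size alpha).-1, i.+1 == sumn (take k.+1 alpha)]].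

(* A diagram is given by the duplicate-free list of its boxes (column, row). *)
Definition diagram := seq (nat * nat).

Definition tcd (alpha : seq nat) : diagram :=
  [seq (j, i) | i <- iota 1 (size alpha), j <- iota 1 (nth 0 alpha i.-1)].

(* D(X_alpha, w_RB), the transpose of tcd(alpha). *)
Definition diagX (alpha : seq nat) : diagram := [seq (b.2, b.1) | b <- tcd alpha].

(* The numbers of boxes in the nonempty rows, from the top row to the bottom one. *)
Definition row_comp (D : diagram) : seq nat :=
  [seq r <- [seq count (fun b => b.2 == y) D
              | y <- rev (iota 1 (\max_(b <- D) b.2))] | 0 < r].

(* The boxes of tcd(alpha) up each column, leftmost column first; T'_alpha
   numbers them in this order. *)
Definition col_boxes (alpha : seq nat) : seq (nat * nat) :=
  [seq b <- [seq (j, i) | j <- iota 1 (\max_(a <- alpha) a),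
                          i <- iota 1 (size alpha)] | b \in tcd alpha].

Definition tabT' (alpha : seq nat) (b : nat * nat) : nat :=
  (index b (col_boxes alpha)).+1.

(* The boxes of tcd(alpha) read right to left in each row, bottom row first. *)
Definition rb_boxes (alpha : seq nat) : seq (nat * nat) :=
  [seq (j, i) | i <- iota 1 (size alpha), j <- rev (iota 1 (nth 0 alpha i.-1))].

Definition w_RB (alpha : seq nat) (T : nat * nat -> nat) : seq nat :=
  [seq T b | b <- rb_boxes alpha].

Definition word (n : nat) (s : 'S_n) : seq nat := [seq (s i).+1 | i <- enum 'I_n].
(* The permutation whose word is w; a default value if there is none, which
   w_RB_tabT' rules out for the word of T'_alpha. *)
Definition perm_of_word (n : nat) (w : seq nat) : 'S_n :=
  odflt 1%g [pick s : 'S_n | word s == w].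

Lemma perm_of_wordK n w : perm_eq w (iota 1 n) -> word (perm_of_word n w) = w.
Proof.
move=> wn; rewrite /perm_of_word; case: pickP => [s /eqP //|nos].
have sw : size w = n by rewrite (perm_size wn) size_iota.
have uw : uniq w by rewrite (perm_uniq wn) iota_uniq.
have mw (i : 'I_n) : (0 < nth 0 w i <= n)%N.
  have : nth 0 w i \in w by rewrite mem_nth ?sw.
  by rewrite (perm_mem wn) mem_iota; lia.
have lw (i : 'I_n) : ((nth 0 w i).-1 < n)%N by have := mw i; lia.
have finj : injective (fun i => Ordinal (lw i)).
  move=> i j [] eij; apply/val_inj/eqP; rewrite -(nth_uniq 0 _ _ uw) ?sw ?ltn_ord //.
  apply/eqP; move: (mw i) (mw j) eij => /=.
  by case: (nth 0 w i) (nth 0 w j) => [|a] [|b] //= _ _ ->.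
case/eqP: (nos (perm finj)); apply: (@eq_from_nth _ 0).
  by rewrite size_map size_enum_ord sw.
move=> k; rewrite size_map size_enum_ord => kn.
rewrite (nth_map (Ordinal kn)) ?size_enum_ord // permE /= nth_enum_ord //.
by have := mw (Ordinal kn); rewrite /=; lia.
Qed.

Lemma perm_rb_col alpha : perm_eq (rb_boxes alpha) (col_boxes alpha).
Proof.
have prt : perm_eq (rb_boxes alpha) (tcd alpha).
  rewrite /rb_boxes /tcd; elim: (iota 1 _) => //= i s IHs.
  by rewrite perm_cat // perm_map // perm_rev.
apply: perm_trans prt _; apply: uniq_perm.
- apply: allpairs_uniq_dep => [|i _|]; rewrite ?iota_uniq //.
  by move=> [i j] [i' j'] _ _ /= [-> ->].
- apply/filter_uniq/allpairs_uniq; rewrite ?iota_uniq //.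
  by move=> [i j] [i' j'] _ _ /= [-> ->].
move=> b; rewrite mem_filter andb_idr // => /allpairsPdep[i [j [si sj ->]]].
apply: allpairs_f => //; move: sj; rewrite !mem_iota => /andP[-> jm].
rewrite (leq_trans jm) // !add1n ltnS; case: (ltnP i.-1 (size alpha)) => ia.
  by apply: leq_bigmax_seq => //; apply: mem_nth.
by rewrite nth_default.
Qed.

Lemma size_rb_boxes alpha : size (rb_boxes alpha) = sumn alpha.
Proof.
rewrite size_allpairs_dep; congr sumn.
apply: (@eq_from_nth _ 0) => [|k]; rewrite size_map size_iota // => ks.
by rewrite (nth_map 0) ?size_iota // nth_iota // size_rev size_iota.
Qed.

Lemma w_RB_tabT' n alpha : is_composition n alpha ->
  word (perm_of_word n (w_RB alpha (tabT' alpha))) = w_RB alpha (tabT' alpha).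
Proof.
case/andP=> _ /eqP an; apply: perm_of_wordK.
have uc : uniq (col_boxes alpha).
  apply/filter_uniq/allpairs_uniq; rewrite ?iota_uniq //.
  by move=> [i j] [i' j'] _ _ /= [-> ->].
apply: perm_trans (perm_map _ (perm_rb_col alpha)) _.
suff -> : [seq tabT' alpha b | b <- col_boxes alpha] = iota 1 n by [].
have sc : size (col_boxes alpha) = n.
  by rewrite -(perm_size (perm_rb_col alpha)) size_rb_boxes.
apply: (@eq_from_nth _ 0) => [|k]; rewrite size_map ?size_iota // => ks.
rewrite (nth_map (0, 0)) // nth_iota -?sc // /tabT'.
by rewrite index_uniq.
Qed.

Local Open Scope ring_scope.
Local Open Scope quotient_scope.

Section HeckeAlgebra.

Variables (F : fieldType) (n : nat).

(* H_n(0) is the quotient of the noncommutative polynomial expressions in the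
   pi_i by the least congruence containing the axioms of unital associative
   F-algebras and the 0-Hecke relations. *)
Inductive hterm : Type :=
| HScal of F
| HGen of 'I_n.-1
| HAdd of hterm & hterm
| HMul of hterm & hterm.

Inductive heq : hterm -> hterm -> Prop :=
| heq_refl t : heq t t
| heq_sym t u : heq t u -> heq u t
| heq_trans t u v : heq t u -> heq u v -> heq t v
| heq_add t t' u u' : heq t t' -> heq u u' -> heq (HAdd t u) (HAdd t' u')
| heq_mul t t' u u' : heq t t' -> heq u u' -> heq (HMul t u) (HMul t' u')
| heq_addA t u v : heq (HAdd t (HAdd u v)) (HAdd (HAdd t u) v)
| heq_addC t u : heq (HAdd t u) (HAdd u t)
| heq_add0 t : heq (HAdd (HScal 0) t) t
| heq_addN t : heq (HAdd (HMul (HScal (-1)) t) t) (HScal 0)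
| heq_mulA t u v : heq (HMul t (HMul u v)) (HMul (HMul t u) v)
| heq_mul1l t : heq (HMul (HScal 1) t) t
| heq_mul1r t : heq (HMul t (HScal 1)) t
| heq_mulDl t u v : heq (HMul (HAdd t u) v) (HAdd (HMul t v) (HMul u v))
| heq_mulDr t u v : heq (HMul t (HAdd u v)) (HAdd (HMul t u) (HMul t v))
| heq_scalD a b : heq (HScal (a + b)) (HAdd (HScal a) (HScal b))
| heq_scalM a b : heq (HScal (a * b)) (HMul (HScal a) (HScal b))
| heq_scalC a t : heq (HMul (HScal a) t) (HMul t (HScal a))
| heq_idem i : heq (HMul (HGen i) (HGen i)) (HGen i)
| heq_braid (i j : 'I_n.-1) : j = i.+1 :> nat ->
    heq (HMul (HMul (HGen i) (HGen j)) (HGen i))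
        (HMul (HMul (HGen j) (HGen i)) (HGen j))
| heq_comm (i j : 'I_n.-1) : (i.+1 < j)%N ->
    heq (HMul (HGen i) (HGen j)) (HMul (HGen j) (HGen i)).

HB.instance Definition _ := gen_eqMixin hterm.
HB.instance Definition _ := gen_choiceMixin hterm.

Definition heqb (t u : hterm) : bool := `[< heq t u >].

Fact heqb_refl : reflexive heqb.
Proof. by move=> t; apply/asboolP; constructor. Qed.
Fact heqb_sym : symmetric heqb.
Proof. by move=> t u; apply/asboolP/asboolP; exact: heq_sym. Qed.
Fact heqb_trans : transitive heqb.
Proof.
by move=> u t v /asboolP tu /asboolP uv; apply/asboolP; exact: heq_trans tu uv.
Qed.

Canonical heqb_equiv := EquivRel heqb heqb_refl heqb_sym heqb_trans.

Definition hecke0 := {eq_quot heqb}.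
HB.instance Definition _ := Choice.on hecke0.

Definition hcl (t : hterm) : hecke0 := \pi_({eq_quot heqb}) t.
Definition hrepr (x : hecke0) : hterm := repr x.

Lemma hreprK x : hcl (hrepr x) = x.
Proof. exact: reprK. Qed.

Lemma hclE t u : hcl t = hcl u <-> heq t u.
Proof.
rewrite /hcl; split=> [/eqP|tu]; first by rewrite eqmodE => /asboolP.
by apply/eqP; rewrite eqmodE; apply/asboolP.
Qed.

Lemma hrepr_cl t : heq (hrepr (hcl t)) t.
Proof. by apply/hclE; rewrite hreprK. Qed.

Definition h_add (x y : hecke0) := hcl (HAdd (hrepr x) (hrepr y)).
Definition h_mul (x y : hecke0) := hcl (HMul (hrepr x) (hrepr y)).
Definition h_scal (a : F) := hcl (HScal a).
Definition h_opp (x : hecke0) := h_mul (h_scal (-1)) x.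

Lemma h_addE t u : h_add (hcl t) (hcl u) = hcl (HAdd t u).
Proof. by apply/hclE; apply: heq_add; exact: hrepr_cl. Qed.
Lemma h_mulE t u : h_mul (hcl t) (hcl u) = hcl (HMul t u).
Proof. by apply/hclE; apply: heq_mul; exact: hrepr_cl. Qed.

Fact h_addA : associative h_add.
Proof.
move=> x y z; rewrite -(hreprK x) -(hreprK y) -(hreprK z) !h_addE.
by apply/hclE; constructor.
Qed.
Fact h_addC : commutative h_add.
Proof.
by move=> x y; rewrite -(hreprK x) -(hreprK y) !h_addE; apply/hclE; constructor.
Qed.
Fact h_add0 : left_id (h_scal 0) h_add.
Proof. by move=> x; rewrite -(hreprK x) h_addE; apply/hclE; constructor. Qed.
Fact h_addN : left_inverse (h_scal 0) h_opp h_add.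
Proof. by move=> x; rewrite -(hreprK x) /h_opp h_mulE h_addE; apply/hclE; constructor. Qed.
HB.instance Definition _ := GRing.isZmodule.Build hecke0 h_addA h_addC h_add0 h_addN.

Fact h_mulA : associative h_mul.
Proof.
move=> x y z; rewrite -(hreprK x) -(hreprK y) -(hreprK z) !h_mulE.
by apply/hclE; constructor.
Qed.
Fact h_mul1l : left_id (h_scal 1) h_mul.
Proof. by move=> x; rewrite -(hreprK x) h_mulE; apply/hclE; constructor. Qed.
Fact h_mul1r : right_id (h_scal 1) h_mul.
Proof. by move=> x; rewrite -(hreprK x) h_mulE; apply/hclE; constructor. Qed.
Fact h_mulDl : left_distributive h_mul +%R.
Proof.
move=> x y z; rewrite -(hreprK x) -(hreprK y) -(hreprK z).
by rewrite /GRing.add /= !(h_mulE, h_addE); apply/hclE; constructor.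
Qed.
Fact h_mulDr : right_distributive h_mul +%R.
Proof.
move=> x y z; rewrite -(hreprK x) -(hreprK y) -(hreprK z).
by rewrite /GRing.add /= !(h_mulE, h_addE); apply/hclE; constructor.
Qed.

(* The representation sending every pi_i to 1 shows that H_n(0) is nonzero. *)
Fixpoint heval1 (t : hterm) : F :=
  match t with
  | HScal a => a
  | HGen _ => 1
  | HAdd t u => heval1 t + heval1 u
  | HMul t u => heval1 t * heval1 u
  end.

Lemma heval1P t u : heq t u -> heval1 t = heval1 u.
Proof.
elim=> //= {t u}; try by move=> *; congruence.
- by move=> t u v; rewrite addrA.
- by move=> t u; rewrite addrC.
- by move=> t; rewrite add0r.
- by move=> t; rewrite mulN1r addNr.
- by move=> t u v; rewrite mulrA.
- by move=> t; rewrite mul1r.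
- by move=> t; rewrite mulr1.
- by move=> t u v; rewrite mulrDl.
- by move=> t u v; rewrite mulrDr.
- by move=> a t; rewrite mulrC.
by move=> _; rewrite mulr1.
Qed.

Fact h_1neq0 : h_scal 1 != 0.
Proof. by apply/eqP => /hclE /heval1P /= /eqP; rewrite oner_eq0. Qed.

HB.instance Definition _ := GRing.Zmodule_isNzRing.Build hecke0
  h_mulA h_mul1l h_mul1r h_mulDl h_mulDr h_1neq0.

Definition h_scale (a : F) (x : hecke0) : hecke0 := h_scal a * x.

Lemma h_scalM a b : h_scal (a * b) = h_scal a * h_scal b.
Proof. by rewrite /GRing.mul /= h_mulE; apply/hclE; constructor. Qed.
Lemma h_scalD a b : h_scal (a + b) = h_scal a + h_scal b.
Proof. by rewrite /GRing.add /= h_addE; apply/hclE; constructor. Qed.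
Lemma h_scalC a x : h_scal a * x = x * h_scal a.
Proof. by rewrite -(hreprK x) /GRing.mul /= !h_mulE; apply/hclE; constructor. Qed.

Fact h_scaleA a b x : h_scale a (h_scale b x) = h_scale (a * b) x.
Proof. by rewrite /h_scale mulrA h_scalM. Qed.
Fact h_scale1 : left_id 1 h_scale.
Proof. exact: h_mul1l. Qed.
Fact h_scaleDr : right_distributive h_scale +%R.
Proof. by move=> a x y; rewrite /h_scale mulrDr. Qed.
Fact h_scaleDl x : {morph h_scale^~ x : a b / a + b}.
Proof. by move=> a b; rewrite /h_scale h_scalD mulrDl. Qed.
HB.instance Definition _ := GRing.Zmodule_isLmodule.Build F hecke0
  h_scaleA h_scale1 h_scaleDr h_scaleDl.

Fact h_scaleAl a (x y : hecke0) : a *: (x * y) = a *: x * y.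
Proof. by rewrite /GRing.scale /= /h_scale mulrA. Qed.
HB.instance Definition _ := GRing.Lmodule_isLalgebra.Build F hecke0 h_scaleAl.
Fact h_scaleAr a (x y : hecke0) : a *: (x * y) = x * (a *: y).
Proof. by rewrite /GRing.scale /= /h_scale [RHS]mulrA -h_scalC mulrA. Qed.
HB.instance Definition _ := GRing.Lalgebra_isAlgebra.Build F hecke0 h_scaleAr.

Definition hgen (i : 'I_n.-1) : hecke0 := hcl (HGen i).

End HeckeAlgebra.

Section HeckeRep.

Variables (F : fieldType) (n : nat) (V : lmodType F).

(* Operators on V satisfying the 0-Hecke relations; hecke_mod turns V into the
   corresponding left module over H_n(0). *)
Record hecke_rep := HeckeRep {
  hop : 'I_n.-1 -> V -> V;
  hop_linear : forall i, linear (hop i);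
  hop_idem : forall i v, hop i (hop i v) = hop i v;
  hop_braid : forall i j : 'I_n.-1, j = i.+1 :> nat ->
    forall v, hop i (hop j (hop i v)) = hop j (hop i (hop j v));
  hop_comm : forall i j : 'I_n.-1, (i.+1 < j)%N ->
    forall v, hop i (hop j v) = hop j (hop i v) }.

Variable r : hecke_rep.

Fixpoint hinterp (t : hterm F n) (v : V) : V :=
  match t with
  | HScal a => a *: v
  | HGen i => hop r i v
  | HAdd t u => hinterp t v + hinterp u v
  | HMul t u => hinterp t (hinterp u v)
  end.

Lemma hinterp_lin t : linear (hinterp t).
Proof.
elim: t => [b|i|t IHt u IHu|t IHt u IHu] a x y /=.
- by rewrite scalerDr !scalerA mulrC.
- exact: hop_linear.
- by rewrite IHt IHu scalerDr addrACA.
- by rewrite IHu IHt.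
Qed.

Lemma hinterpD t x y : hinterp t (x + y) = hinterp t x + hinterp t y.
Proof. by have := hinterp_lin t 1 x y; rewrite !scale1r. Qed.
Lemma hinterp0 t : hinterp t 0 = 0.
Proof. by apply: (addrI (hinterp t 0)); rewrite -hinterpD !addr0. Qed.
Lemma hinterpZ t a x : hinterp t (a *: x) = a *: hinterp t x.
Proof. by rewrite -[a *: x]addr0 hinterp_lin hinterp0 addr0. Qed.

Lemma hinterpP t u : heq t u -> hinterp t =1 hinterp u.
Proof.
elim=> {t u} /=.
- by [].
- by move=> t u _ IH v; rewrite IH.
- by move=> t u v _ IH1 _ IH2 w; rewrite IH1 IH2.
- by move=> t t' u u' _ IH1 _ IH2 w; rewrite IH1 IH2.
- by move=> t t' u u' _ IH1 _ IH2 w; rewrite IH1 IH2.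
- by move=> t u v w; rewrite addrA.
- by move=> t u w; rewrite addrC.
- by move=> t w; rewrite scale0r add0r.
- by move=> t w; rewrite scaleN1r addNr scale0r.
- by [].
- by move=> t w; rewrite scale1r.
- by move=> t w; rewrite scale1r.
- by [].
- by move=> t u v w; rewrite hinterpD.
- by move=> a b w; rewrite scalerDl.
- by move=> a b w; rewrite scalerA.
- by move=> a t w; rewrite hinterpZ.
- by move=> i w; exact: hop_idem.
- by move=> i j ij w; exact: hop_braid.
- by move=> i j ij w; exact: hop_comm.
Qed.

End HeckeRep.

Definition hecke_mod (F : fieldType) (n : nat) (V : lmodType F)
  (r : hecke_rep n V) : Type := V.

Section HeckeMod.

Variables (F : fieldType) (n : nat) (V : lmodType F) (r : hecke_rep n V).

HB.instance Definition _ := GRing.Zmodule.copy (hecke_mod r) V.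

Definition hact (x : hecke0 F n) (v : hecke_mod r) : hecke_mod r :=
  hinterp r (hrepr x) v.

Lemma hactE t v : hact (hcl t) v = hinterp r t v.
Proof. exact/hinterpP/hrepr_cl. Qed.

Fact hactA x y v : hact x (hact y v) = hact (x * y) v.
Proof. by rewrite -(hreprK x) -(hreprK y) /GRing.mul /= h_mulE !hactE. Qed.
Fact hact1 : left_id 1 hact.
Proof. by move=> v; rewrite hactE /= scale1r. Qed.
Fact hactDr : right_distributive hact +%R.
Proof. by move=> x u v; exact: hinterpD. Qed.
Fact hactDl v : {morph hact^~ v : x y / x + y}.
Proof.
by move=> x y; rewrite -(hreprK x) -(hreprK y) {1}/GRing.add /= h_addE !hactE.
Qed.

HB.instance Definition _ := GRing.Zmodule_isLmodule.Build (hecke0 F n)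
  (hecke_mod r) hactA hact1 hactDr hactDl.

Lemma hgen_act i (v : hecke_mod r) : hgen F i *: v = hop r i v.
Proof. exact: hactE. Qed.
Lemma hscal_act (a : F) (v : hecke_mod r) : (a%:A : hecke0 F n) *: v = a *: (v : V).
Proof.
have -> : (a%:A : hecke0 F n) = h_scal n a by rewrite -[LHS]/(h_scal n a * 1) mulr1.
exact: hactE.
Qed.

End HeckeMod.

Section WeakBruhatModule.

Variables (F : fieldType) (n : nat) (sigma rho : 'S_n).

Local Notation I := {z : 'S_n | z \in intervalL sigma rho}.
Local Notation V := {ffun I -> F^o}.

(* V is the space of formal linear combinations of I; bvec z is the basis
   vector of z. *)
Definition bvec (z : I) : V := [ffun z' => (z' == z)%:R].

Definition pi_basis (i : 'I_n.-1) (z : I) : V :=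
  if i \in desL (val z) then bvec z
  else oapp bvec 0 (insub (pmul (sgen i) (val z))).

Definition pi_op (i : 'I_n.-1) (v : V) : V := \sum_(z : I) v z *: pi_basis i z.

Fact pi_op_linear i : linear (pi_op i).
Proof.
move=> a u v; rewrite /pi_op scaler_sumr -big_split; apply: eq_bigr => z _ /=.
by rewrite !ffunE scalerDl scalerA.
Qed.

Lemma pi_op_bvec i z : pi_op i (bvec z) = pi_basis i z.
Proof.
rewrite /pi_op (bigD1 z) //= ffunE eqxx scale1r big1 ?addr0 // => z' /negPf nz.
by rewrite ffunE nz scale0r.
Qed.

Lemma bvec_sum (v : V) : v = \sum_z v z *: bvec z.
Proof.
apply/ffunP => z; rewrite sum_ffunE (bigD1 z) //= big1 => [|z' nz].
  by rewrite addr0 !ffunE eqxx -[RHS]/(v z * 1) mulr1.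
by rewrite !ffunE eq_sym (negPf nz) -[LHS]/(v z' * 0) mulr0.
Qed.

Let bv (x : 'S_n) : V := oapp bvec 0 (insub x).

Let bvE x (xI : x \in intervalL sigma rho) : bv x = bvec (Sub x xI).
Proof. by rewrite /bv insubT. Qed.

Lemma pi_op0 i : pi_op i 0 = 0.
Proof. by rewrite /pi_op big1 // => z _; rewrite ffunE scale0r. Qed.

Let bv_demz i x : leL sigma x -> pi_op i (bv x) = bv (demz i x).
Proof.
move=> sx; have [xI|xI] := boolP (x \in intervalL sigma rho).
  rewrite bvE pi_op_bvec /pi_basis SubK /demz; case: ifP => //.
rewrite {1}/bv insubN // pi_op0 /bv insubN //.
apply: contra xI; rewrite !inE sx => /andP[_] /=.
exact/connect_trans/leL_demz.
Qed.

Let bv_val (z : I) : bvec z = bv (val z).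
Proof. by rewrite /bv valK. Qed.

Let leL_val (z : I) : leL sigma (val z).
Proof. by have := valP z; rewrite inE => /andP[]. Qed.

Let leL_demz' i x : leL sigma x -> leL sigma (demz i x).
Proof. by move=> sx; apply: connect_trans sx _; exact: leL_demz. Qed.

Lemma pi_op_sum i v : pi_op i v = \sum_z v z *: pi_op i (bvec z).
Proof. by apply: eq_bigr => z _; rewrite pi_op_bvec. Qed.

HB.instance Definition _ i := GRing.isLinear.Build F V V *:%R (pi_op i) (@pi_op_linear i).

Let op_ext (f g : {linear V -> V}) : (forall z, f (bvec z) = g (bvec z)) -> f =1 g.
Proof.
move=> fg v; rewrite [v]bvec_sum !linear_sum; apply: eq_bigr => z _.
by rewrite !linearZ fg.
Qed.

Lemma demz_idem i (x : 'S_n) : demz i (demz i x) = demz i x.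
Proof. by apply: invg_inj; rewrite !demzV srt_idem ?lo_neq_hi. Qed.

Lemma demz_braid (i j : 'I_n.-1) (x : 'S_n) : j = i.+1 :> nat ->
  demz i (demz j (demz i x)) = demz j (demz i (demz j x)).
Proof.
move=> ij; apply: invg_inj; rewrite !demzV.
have -> : hi i = lo j by apply: val_inj; rewrite /= ij.
by apply: srt_braid; rewrite /= !inE -!val_eqE /= ij; lia.
Qed.

Lemma demz_comm (i j : 'I_n.-1) (x : 'S_n) : (i.+1 < j)%N ->
  demz i (demz j x) = demz j (demz i x).
Proof.
move=> ij; apply: invg_inj; rewrite !demzV.
by apply: srt_comm; rewrite /= !inE -!val_eqE /=; lia.
Qed.

Fact pi_op_idem i v : pi_op i (pi_op i v) = pi_op i v.
Proof.
apply: (op_ext (f := pi_op i \o pi_op i) (g := pi_op i)) => z /=.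
by rewrite bv_val !bv_demz ?leL_demz' // demz_idem.
Qed.

Fact pi_op_braid (i j : 'I_n.-1) : j = i.+1 :> nat ->
  forall v, pi_op i (pi_op j (pi_op i v)) = pi_op j (pi_op i (pi_op j v)).
Proof.
move=> ij; apply: (op_ext (f := pi_op i \o (pi_op j \o pi_op i))
                          (g := pi_op j \o (pi_op i \o pi_op j))) => z /=.
by rewrite bv_val !bv_demz ?leL_demz' // demz_braid.
Qed.

Fact pi_op_comm (i j : 'I_n.-1) : (i.+1 < j)%N ->
  forall v, pi_op i (pi_op j v) = pi_op j (pi_op i v).
Proof.
move=> ij; apply: (op_ext (f := pi_op i \o pi_op j) (g := pi_op j \o pi_op i)) => z /=.
by rewrite bv_val !bv_demz ?leL_demz' // demz_comm.
Qed.

Definition Brep : hecke_rep n V :=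
  HeckeRep pi_op_linear pi_op_idem pi_op_braid pi_op_comm.

(* B([sigma, rho]_L); the zero module if the interval is empty. *)
Definition Bmod : lmodType (hecke0 F n) := hecke_mod Brep.

Lemma hgen_bvec (i : 'I_n.-1) (z : I) :
  hgen F i *: (bvec z : Bmod) = pi_basis i z :> Bmod.
Proof. by rewrite hgen_act /= pi_op_bvec. Qed.

End WeakBruhatModule.

(* X_alpha through its known description as a weak Bruhat interval module. *)
Definition Xmod (F : fieldType) (n : nat) (alpha : seq nat) : lmodType (hecke0 F n) :=
  Bmod F (w0S (~: compset n alpha)) (perm_of_word n (w_RB alpha (tabT' alpha))).

Section ModuleNotions.

Variable A : pzRingType.
Implicit Types M N P Q X : lmodType A.

Definition fin_gen M : Prop :=
  exists s : seq M, forall m : M, exists c : 'I_(size s) -> A,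
    m = \sum_(k < size s) c k *: s`_k.

(* Injective objects of the category of finitely generated left A-modules. *)
Definition injective_fg Q : Prop :=
  forall M N, fin_gen M -> fin_gen N ->
  forall (g : {linear M -> N}) (h : {linear M -> Q}), injective g ->
  exists k : {linear N -> Q}, forall m, k (g m) = h m.

(* Every nonzero submodule of Q meets the image of f nontrivially. *)
Definition essential X Q (f : {linear X -> Q}) : Prop :=
  forall S : {pred Q}, submod_closed S -> (exists2 q, q \in S & q != 0) ->
  exists2 x, f x \in S & f x != 0.

Definition injective_hull X Q : Prop :=
  [/\ fin_gen Q, injective_fg Q
    & exists f : {linear X -> Q}, injective f /\ essential f].

Definition projective P : Prop :=
  forall M N (g : {linear M -> N}) (h : {linear P -> N}),
  (forall y, exists x, g x = y) ->
  exists k : {linear P -> M}, forall p, g (k p) = h p.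

Definition indecomposable M : Prop :=
  (exists m : M, m != 0) /\
  forall S T : {pred M}, submod_closed S -> submod_closed T ->
  (forall m, exists s t, [/\ s \in S, t \in T & m = s + t]) ->
  (forall m, m \in S -> m \in T -> m = 0) ->
  (forall m, m \in S -> m = 0) \/ (forall m, m \in T -> m = 0).

End ModuleNotions.

(* Main.v *)
From HB Require Import structures.
Require Import Defs.
From mathcomp Require Import all_boot all_order all_algebra all_fingroup.
From mathcomp Require Import generic_quotient boolp zify.

Set Implicit Arguments.
Unset Strict Implicit.
Unset Printing Implicit Defensive.

Import GRing.Theory.

(* P := B([w_0(S), w_1(S)]_L) has as basis the permutations z with right descent set S.

   Projectivity: write b_i := 1 - pi_i.  For every module M and m in M,
   z |-> pi_z b_{w_0(S^c)} m is a homomorphism P -> M, since a step leaving P creates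
   a right descent j outside S and pi_j b_j = 0.  For M = P and m = w_0(S) it is the
   identity up to longer permutations, hence bijective; lifting m lifts homomorphisms.

   Injectivity is dual: for every linear functional l on M,
   m |-> sum_z (-1)^(length z) l(pi_{w_0(T)} b_{z^-1 w_0} m) z, with T the left descent
   set of w_1(S), is a homomorphism M -> P; for M = P and l the coefficient of w_1(S)
   it is injective.  Functionals extend from submodules.

   Every nonzero submodule N of P contains w_1(S): if q in N is nonzero and w is of
   maximal length with u := pi_w q nonzero, then each pi_i fixes or kills u, and the two
   triangularity properties above force u to be a multiple of w_1(S).  Hence P is
   indecomposable and every nonzero homomorphism into P is essential.

   Finally X_alpha embeds into P by rereading a standard extended tableau along its
   columns, rightmost column first, instead of along its rows: both readings have the
   same left descents, because i+1 can never lie strictly northeast of i. *)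

(** * Descents and inversion sets *)

Section Permutations.

Variable n : nat.
Implicit Types (i j : 'I_n.-1) (s t x y z w : 'S_n) (S T : {set 'I_n.-1}).

Definition desR s : {set 'I_n.-1} := [set i | (s (hi i) < s (lo i))%N].

Lemma mem_desR i s : (i \in desR s) = (s (hi i) < s (lo i))%N.
Proof. by rewrite inE. Qed.

Lemma desLE s : desL s = desR s^-1%g.
Proof. by apply/setP => i; rewrite mem_desL mem_desR. Qed.

Lemma desRE s : desR s = desL s^-1%g.
Proof. by rewrite desLE invgK. Qed.

Lemma perm_ltn s (a b : 'I_n) : a != b -> (s a < s b)%N = ~~ (s b < s a)%N.
Proof.
by case: ltngtP => // /val_inj/perm_inj ->; rewrite eqxx.
Qed.

Lemma lo_hi_ltn i : (lo i < hi i)%N. Proof. exact: leqnn. Qed.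

Lemma notin_desL i s : (i \notin desL s) = (s^-1%g (lo i) < s^-1%g (hi i))%N.
Proof. by rewrite mem_desL [RHS]perm_ltn ?lo_neq_hi. Qed.

Lemma notin_desR i s : (i \notin desR s) = (s (lo i) < s (hi i))%N.
Proof. by rewrite mem_desR [RHS]perm_ltn ?lo_neq_hi. Qed.

Lemma ninvV s : ninv s^-1%g = ninv s.
Proof.
pose f (p : 'I_n * 'I_n) := (s p.2, s p.1).
have fI : injective f by case=> [a b] [c d] [] /perm_inj -> /perm_inj ->.
rewrite /ninv -[RHS](card_imset _ fI); congr #|pred_of_set _|; apply/setP=> -[a b].
apply/idP/imsetP => /=.
  rewrite inE /= => /andP[ab sba]; exists (s^-1%g b, s^-1%g a); rewrite /f /= ?permKV //.
  by rewrite inE /= !permKV sba.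
case=> -[c d]; rewrite inE /= => /andP[cd sdc] [-> ->].
by rewrite inE /= !permK sdc cd.
Qed.

Lemma ninvMsgen i s :
  ninv (s * sgen i)%g = if i \in desL s then (ninv s).-1 else (ninv s).+1.
Proof. by rewrite -ninvV invMg tpermV ninv_step -mem_desL ninvV. Qed.

Lemma ninv_desL_gt0 i s : i \in desL s -> (0 < ninv s)%N.
Proof. by rewrite mem_desL => /ninv_gt0; rewrite ninvV. Qed.

Lemma desL_sgen i s : (i \in desL (s * sgen i)%g) = (i \notin desL s).
Proof. by rewrite notin_desL mem_desL invMg tpermV !permM tpermL tpermR. Qed.

Lemma desL_neq0 s : s != 1%g -> exists i, i \in desL s.
Proof. by rewrite -invg_eq1 => /descent_ex[i]; exists i; rewrite mem_desL. Qed.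

Lemma mulsgenK i s : (s * sgen i * sgen i)%g = s.
Proof. by rewrite -mulgA tperm2 mulg1. Qed.

(** * The left weak order *)

Lemma mem_invset s (a b : 'I_n) : ((a, b) \in invset s) = (a < b)%N && (s b < s a)%N.
Proof. by rewrite inE. Qed.

Lemma desR_invset i s : (i \in desR s) = ((lo i, hi i) \in invset s).
Proof. by rewrite mem_invset lo_hi_ltn mem_desR. Qed.

(** Exchanging the neighbouring values [lo i] and [hi i] changes the relative order at no other pair
    of positions. *)
Lemma invset_cover i s : i \notin desL s ->
  invset (s * sgen i)%g = (s^-1%g (lo i), s^-1%g (hi i)) |: invset s.
Proof.
rewrite notin_desL => si; apply/setP=> -[a b]; rewrite in_setU1 !mem_invset !permM.
have [[-> ->]|ne] := eqVneq (a, b) (s^-1%g (lo i), s^-1%g (hi i)).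
  by rewrite !permKV /sgen tpermL tpermR si lo_hi_ltn.
case ab: (a < b)%N => //=.
have nab : s a != s b by apply: contraTneq ab => /perm_inj ->; rewrite ltnn.
have [sab|sba|/val_inj/perm_inj e] := ltngtP (s a) (s b); last by rewrite e ltnn in ab.
- apply/negbTE; rewrite -leqNgt ltnW //; apply: sgen_ltn => //.
  by apply: contra ne => /eqP[<- <-]; rewrite !permK.
- apply: sgen_ltn => //; apply/eqP => -[sb sa].
  by move: si; rewrite -sa -sb !permK ltnNge ltnW.
Qed.

Lemma leL_ind (K : 'S_n -> Prop) s t : K s ->
  (forall z i, leL s z -> i \notin desL z -> K z -> K (z * sgen i)%g) ->
  leL s t -> K t.
Proof.
move=> Ks step /connectP[p]; elim/last_ind: p t => [|p z IH] t; first by move=> _ ->.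
rewrite rcons_path last_rcons => /andP[sp /existsP[i /andP[pi /eqP ->]]] ->.
by apply: step => //; [apply/connectP; exists p | exact: IH].
Qed.

Lemma leL_ind_down (K : 'S_n -> Prop) s t : K t ->
  (forall z i, leL z t -> i \in desL z -> K z -> K (z * sgen i)%g) ->
  leL s t -> K s.
Proof.
move=> Kt step /connectP[p]; elim: p s => [|z p IH] s /=; first by move=> _ <-.
move=> /andP[/existsP[i /andP[si /eqP zE]] zp] te.
have := IH z zp te; rewrite zE => /(step _ i); rewrite mulsgenK desL_sgen; apply=> //.
by rewrite -[X in leL X _]/(pmul (sgen i) s) -zE; apply/connectP; exists p.
Qed.

Lemma leL_sgen i s : i \notin desL s -> leL s (s * sgen i)%g.
Proof. by move=> si; apply/connect1/existsP; exists i; rewrite si eqxx. Qed.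

Lemma leL_trans : transitive (@leL n). Proof. exact: connect_trans. Qed.

Lemma leL_refl s : leL s s. Proof. exact: connect0. Qed.

(** Listed by increasing values of [s], the entries of [t] have a descent [i]. Were [i] a left
    descent of [s] as well, the two positions would form an inversion of [s] but not of [t]. So [s]
    can be raised at [i], and the inversion gained belongs to [t]. *)
Lemma cover_subset s t : s != t -> invset s \subset invset t ->
  exists2 i, i \notin desL s & invset (s * sgen i)%g \subset invset t.
Proof.
move=> nst sst; have : (s^-1 * t != 1)%g.
  by rewrite -(inj_eq (mulgI s)) mulKVg mulg1 eq_sym.
case/descent_ex=> i; rewrite !permM => ti.
suff si : i \notin desL s.
  by exists i; rewrite ?invset_cover // subUset sub1set mem_invset ti -notin_desL si.
apply: contraL ti => si; rewrite -leqNgt ltnW //.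
have : (s^-1%g (hi i), s^-1%g (lo i)) \in invset t.
  by apply: (subsetP sst); rewrite mem_invset -mem_desL si !permKV lo_hi_ltn.
by rewrite mem_invset => /andP[].
Qed.

Lemma leLP s t : leL s t = (invset s \subset invset t).
Proof.
apply/idP/idP.
  apply: (leL_ind (K := fun z => invset s \subset invset z)) => [//|z i _ zi sz].
  by rewrite invset_cover // subsetU // sz orbT.
have [m] := ubnP (ninv t - ninv s); elim: m s => // m IH s lm sst.
have [->|/cover_subset] := eqVneq s t; first exact: leL_refl.
case/(_ sst)=> i si sit; apply: leL_trans (leL_sgen si) _; apply: IH => //.
have := subset_leq_card sit; rewrite -/(ninv _) -/(ninv t) ninvMsgen (negPf si); lia.
Qed.

Lemma leL_ninv s t : leL s t -> (ninv s <= ninv t)%N.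
Proof. by rewrite leLP => /subset_leq_card. Qed.

Lemma leL_cover s t : s != t -> leL s t ->
  exists2 i, i \notin desL s & leL (s * sgen i)%g t.
Proof.
move=> st; rewrite leLP => /(cover_subset st)[i si it].
by exists i; rewrite ?leLP.
Qed.

Lemma leL_desR s t : leL s t -> desR s \subset desR t.
Proof.
by rewrite leLP => /subsetP st; apply/subsetP => i; rewrite !desR_invset => /st.
Qed.

(** * Demazure products *)

(** Mirror image of [demz]: as [*] applies its left factor first, this step acts on positions, while
    [demz] acts on values. *)
Definition demzR j s : 'S_n := if j \in desR s then s else (sgen j * s)%g.

Lemma demzE i s : demz i s = if i \in desL s then s else (s * sgen i)%g.
Proof. by []. Qed.

Lemma demzRE j s : demzR j s = (demz j s^-1)^-1%g.
Proof.
by rewrite demzE -desRE /demzR; case: ifP; rewrite ?invMg ?tpermV ?invgK.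
Qed.

Lemma mem_desL_demz i s : i \in desL (demz i s).
Proof. by rewrite demzE; case: ifPn => // si; rewrite desL_sgen. Qed.

Lemma ninv_demz i s : (ninv s <= ninv (demz i s))%N.
Proof. by rewrite leL_ninv // leL_demz. Qed.

Lemma ninv_demzR j s : (ninv s <= ninv (demzR j s))%N.
Proof. by rewrite demzRE ninvV -[X in (X <= _)%N]ninvV ninv_demz. Qed.

Lemma demz_fixed i s : (demz i s == s) = (i \in desL s).
Proof.
apply/eqP/idP => [<-|]; [exact: mem_desL_demz | by rewrite demzE => ->].
Qed.

Lemma desL_sgenR i j s : j \notin desR s -> i \in desL s -> i \in desL (sgen j * s)%g.
Proof.
rewrite notin_desR !mem_desL invMg tpermV !permM => sj si; apply: sgen_ltn => //.
apply/eqP => -[hl ll]; move: sj; rewrite -hl -ll !permKV; by rewrite ltnNge leqnSn.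
Qed.

Lemma demz_demzR_desL i j s : i \in desL s -> demz i (demzR j s) = demzR j (demz i s).
Proof.
move=> si; apply/eqP; rewrite [demz i s]demzE si demz_fixed /demzR.
by case: ifPn => // sj; exact: desL_sgenR.
Qed.

(** A descent on one side survives an upward step on the other. Two upward steps interfere only when
    the two values sit at the two positions, and then both give the same permutation. *)
Lemma demz_demzR i j s : demz i (demzR j s) = demzR j (demz i s).
Proof.
have [si|si] := boolP (i \in desL s); first exact: demz_demzR_desL.
have [sj|sj] := boolP (j \in desR s).
  move: sj; rewrite !demzRE desRE => /(demz_demzR_desL i)/(congr1 invg).
  by rewrite !demzRE !invgK => ->.
have [e|e] := eqVneq (s^-1%g (lo i), s^-1%g (hi i)) (lo j, hi j).
  suff E : (sgen j * s = s * sgen i)%g.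
    rewrite /demzR (negPf sj) E !demzE (negPf si) desL_sgen si -E.
    by rewrite desRE invMg tpermV desL_sgen -desRE sj.
  case: e => el eh; rewrite /sgen -el -eh; apply: (mulgI s^-1%g).
  by rewrite mulKg -[LHS]/(_ ^ _)%g tpermJ !permKV.
rewrite /demzR (negPf sj) !demzE (negPf si).
have -> : i \in desL (sgen j * s)%g = false.
  apply: negbTE; rewrite notin_desL invMg tpermV !permM; apply: sgen_ltn => //.
  by rewrite -notin_desL.
have -> : j \in desR (s * sgen i)%g = false.
  apply: negbTE; rewrite notin_desR !permM; apply: sgen_ltn; first by rewrite -notin_desR.
  by apply: contra e => /eqP[<- <-]; rewrite !permK.
by rewrite mulgA.
Qed.

(** Upward steps from [T] are repeated until none is left; the number of pairs of positions bounds
    the length. This trades a word for a longer one with prescribed descents when the letters of [T]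
    act trivially. *)
Lemma demz_saturate (Q : 'S_n -> Prop) T s :
  (forall i w, i \in T -> Q w -> Q (demz i w)) -> Q s ->
  exists w, [/\ Q w, (ninv s <= ninv w)%N & T \subset desL w].
Proof.
move=> QT; have [m] := ubnP (#|{: 'I_n * 'I_n}| - ninv s); elim: m s => // m IH s lm Qs.
have [sT|/subsetPn[i iT si]] := boolP (T \subset desL s); first by exists s.
have ns : ninv (demz i s) = (ninv s).+1 by rewrite demzE (negPf si) ninvMsgen (negPf si).
have le : (ninv (demz i s) <= #|{: 'I_n * 'I_n}|)%N by exact: max_card.
have [|w [Qw lw Tw]] := IH (demz i s) _ (QT i s iT Qs).
  by lia.
by exists w; split=> //; rewrite (leq_trans _ lw) // ns.
Qed.

Lemma demzR_saturate (Q : 'S_n -> Prop) T s :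
  (forall i w, i \in T -> Q w -> Q (demzR i w)) -> Q s ->
  exists w, [/\ Q w, (ninv s <= ninv w)%N & T \subset desR w].
Proof.
move=> QT Qs; have [||w [Qw lw Tw]] := @demz_saturate (fun w => Q w^-1%g) T s^-1%g.
- by move=> i w iT Qw; have := QT i _ iT Qw; rewrite demzRE invgK.
- by rewrite invgK.
by exists w^-1%g; rewrite desRE invgK -[ninv w^-1%g]ninvV invgK -[ninv s]ninvV.
Qed.

(** * Parabolic subgroups *)

Definition parab T : {set 'S_n} := <<[set sgen i | i in T]>>%g.

(** A generator of index other than [i] preserves the initial segment ending at [i], hence so does
    the group generated. *)
Lemma parab_stable T i w (a : 'I_n) : w \in parab T -> i \notin T ->
  (w a <= i)%N = (a <= i)%N.
Proof.
move=> wT iT; suff /subsetP/(_ w wT) : parab T \subset ('N([set b : 'I_n | b <= i] | 'P))%g.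
  by move/(astabs_act a); rewrite !inE.
rewrite gen_subG; apply/subsetP=> _ /imsetP[j jT ->]; apply/astabsP=> b /=.
rewrite !inE apermE val_sgen; have : nat_of_ord j != i.
  by apply: contra iT => /eqP/val_inj <-.
by case: ifP => [/eqP->|_]; [lia | case: ifP => // /eqP->; lia].
Qed.

Lemma parab_desR T w : w \in parab T -> desR w \subset T.
Proof.
move=> wT; apply/subsetP => i; apply: contraLR => iT.
rewrite notin_desR; have := parab_stable (hi i) wT iT.
by have := parab_stable (lo i) wT iT; rewrite /= leqnn ltnn; lia.
Qed.

Lemma parab_desL T w : w \in parab T -> desL w \subset T.
Proof. by move=> wT; rewrite desLE parab_desR // groupV. Qed.

Lemma mem_sgen i T : i \in T -> sgen i \in parab T.
Proof. by move=> iT; apply/mem_gen/imset_f. Qed.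

Lemma longest_max (A : {set 'S_n}) z : 1%g \in A -> z \in A ->
  (ninv z <= ninv (longest A))%N.
Proof.
move=> A1 zA; rewrite /longest; case: arg_maxnP => // y yA /(_ z zA).
by rewrite !lenE !ninvV.
Qed.

Lemma longest_in (A : {set 'S_n}) : 1%g \in A -> longest A \in A.
Proof. by move=> A1; rewrite /longest; case: arg_maxnP. Qed.

Lemma w0S_in S : w0S S \in parab S.
Proof. by apply: longest_in; rewrite group1. Qed.

Lemma desL_w0S S : desL (w0S S) = S.
Proof.
apply/eqP; rewrite eqEsubset (parab_desL (w0S_in S)); apply/subsetP => i iS.
have : (ninv (w0S S * sgen i)%g <= ninv (w0S S))%N.
  by apply: longest_max; rewrite ?group1 // groupM ?w0S_in ?mem_sgen.
by rewrite ninvMsgen; case: ifP => // _; rewrite ltnn.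
Qed.

Lemma desR_w0S S : desR (w0S S) = S.
Proof.
apply/eqP; rewrite eqEsubset (parab_desR (w0S_in S)); apply/subsetP => i iS.
have : (ninv (sgen i * w0S S)%g <= ninv (w0S S))%N.
  by apply: longest_max; rewrite ?group1 // groupM ?w0S_in ?mem_sgen.
by rewrite ninv_step mem_desR; case: ifP => // _; rewrite ltnn.
Qed.

Lemma decreasing_run s (a b : 'I_n) : (a < b)%N ->
  (forall i, (a <= i < b)%N -> i \in desR s) -> (s b < s a)%N.
Proof.
case: b => b; elim: b => //= b IH bn ab des.
have bn' : (b < n.-1)%N by lia.
have := des (Ordinal bn'); rewrite /= leqnn andbT -ltnS ab => /(_ isT).
rewrite mem_desR (_ : hi _ = Ordinal bn); last exact: val_inj.
rewrite (_ : lo _ = Ordinal (ltnW bn)); last exact: val_inj.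
move: ab; rewrite ltnS leq_eqVlt => /orP[/eqP ab|ab].
  by rewrite (_ : Ordinal (ltnW bn) = a) //; apply: val_inj.
move=> sb; apply: ltn_trans sb (IH _ ab _) => i /andP[ai ib].
by apply: des; rewrite ai ltnW.
Qed.

Lemma increasing_run s (a b : 'I_n) : (a < b)%N ->
  (forall i, (a <= i < b)%N -> i \notin desR s) -> (s a < s b)%N.
Proof.
case: b => b; elim: b => //= b IH bn ab des.
have bn' : (b < n.-1)%N by lia.
have := des (Ordinal bn'); rewrite /= leqnn andbT -ltnS ab => /(_ isT).
rewrite notin_desR (_ : hi _ = Ordinal bn); last exact: val_inj.
rewrite (_ : lo _ = Ordinal (ltnW bn)); last exact: val_inj.
move: ab; rewrite ltnS leq_eqVlt => /orP[/eqP ab|ab].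
  by rewrite (_ : Ordinal (ltnW bn) = a) //; apply: val_inj.
move=> sb; apply: ltn_trans (IH _ ab _) sb => i /andP[ai ib].
by apply: des; rewrite ai ltnW.
Qed.

(** The parabolic subgroup preserves initial segments that end at an index outside [S], which
    forbids inversions across such a cut; along a run of indices in [S] the word decreases. *)
Lemma w0S_invset S (a b : 'I_n) :
  reflect ((a < b)%N /\ forall i, (a <= i < b)%N -> i \in S)
          ((a, b) \in invset (w0S S)).
Proof.
rewrite mem_invset; apply: (iffP andP) => -[ab].
  move=> sba; split=> // i /andP[ai ib]; apply: contraLR sba => iS.
  have := parab_stable a (w0S_in S) iS; have := parab_stable b (w0S_in S) iS.
  by rewrite ai; lia.
by move=> h; split=> //; apply: decreasing_run => // i /h; rewrite desR_w0S.
Qed.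

Lemma w0_ltn (a b : 'I_n) : (w0 n b < w0 n a)%N = (a < b)%N.
Proof.
have dw i : i \in desR (w0 n).
  have : (ninv (sgen i * w0 n)%g <= ninv (w0 n))%N by apply: longest_max; rewrite inE.
  by rewrite ninv_step mem_desR; case: ifP => // _; rewrite ltnn.
have lt (c d : 'I_n) : (c < d)%N -> (w0 n d < w0 n c)%N by move=> cd; exact: decreasing_run.
have [/lt//|/lt|/val_inj->] := ltngtP a b; last by rewrite ltnn.
by rewrite ltnNge => /negbTE h; apply/negbTE; move: h; lia.
Qed.

(** The composite with the order reversal has no descent, so it is the identity. *)
Lemma w0E (a : 'I_n) : w0 n a = rev_ord a.
Proof.
have rI : injective (@rev_ord n) := can_inj rev_ordK.
suff /permP/(_ a) : (w0 n * perm rI)%g = 1%g.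
  by rewrite permM permE perm1 => /(congr1 (@rev_ord n)); rewrite rev_ordK.
apply/eqP; apply: contraPT isT => /descent_ex[i]; rewrite !permM !permE /=.
have := w0_ltn (lo i) (hi i); rewrite lo_hi_ltn.
by have := ltn_ord (w0 n (lo i)); have := ltn_ord (w0 n (hi i)); lia.
Qed.

Lemma w0K : (w0 n * w0 n)%g = 1%g.
Proof. by apply/permP => a; rewrite permM !w0E rev_ordK perm1. Qed.

Lemma w0V : (w0 n)^-1%g = w0 n.
Proof. by apply/eqP; rewrite eq_invg_mul w0K. Qed.

Lemma ninvMw0 s : (ninv (s * w0 n)%g + ninv s)%N = ninv (w0 n).
Proof.
have id1 x : ninv x = #|invset x| by [].
have e : invset (w0 n) = [set p : 'I_n * 'I_n | (p.1 < p.2)%N].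
  by apply/setP => -[a b]; rewrite mem_invset w0_ltn inE andbb.
rewrite addnC [RHS]id1 e -[RHS](cardsID (invset s)); congr addn.
  by congr #|pred_of_set _|; apply/setP => -[a b]; rewrite !inE /=; case: ltnP.
congr #|pred_of_set _|; apply/setP => -[a b].
rewrite !inE /= !permM w0_ltn andbC; case ab: (a < b)%N; rewrite ?(andbF, andbT) //=.
by rewrite perm_ltn //; apply: contraTneq ab => ->; rewrite ltnn.
Qed.

Lemma desR_Mw0 i s : (i \in desR (s * w0 n)%g) = (i \notin desR s).
Proof. by rewrite notin_desR mem_desR !permM w0_ltn. Qed.

Lemma rev_hi i : rev_ord (hi i) = lo (rev_ord i).
Proof. by apply: val_inj => /=; have := ltn_ord i; lia. Qed.

Lemma rev_lo i : rev_ord (lo i) = hi (rev_ord i).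
Proof. by apply: val_inj => /=; have := ltn_ord i; lia. Qed.

Lemma desL_Mw0 i s : (i \in desL (s * w0 n)%g) = (rev_ord i \notin desL s).
Proof.
by rewrite mem_desL notin_desL invMg w0V !permM !w0E rev_hi rev_lo.
Qed.

Lemma sgenJw0 i : (sgen i ^ w0 n)%g = sgen (rev_ord i).
Proof. by rewrite /sgen tpermJ !w0E rev_hi rev_lo tpermC. Qed.

Lemma w1S_invset S (a b : 'I_n) :
  ((a, b) \in invset (w1S S)) = (a < b)%N && ((a, b) \notin invset (w0S (~: S))).
Proof.
rewrite !mem_invset /w1S /pmul !permM w0_ltn; case ab: (a < b)%N => //=.
by rewrite perm_ltn //; apply: contraTneq ab => ->; rewrite ltnn.
Qed.

Lemma leL_w0S S z : leL (w0S S) z = (S \subset desR z).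
Proof.
apply/idP/idP => [/leL_desR|/subsetP Sz]; first by rewrite desR_w0S.
rewrite leLP; apply/subsetP => -[a b] /w0S_invset[ab h]; rewrite mem_invset ab.
by apply: decreasing_run => // i /h /Sz.
Qed.

Lemma desR_w1S S : desR (w1S S) = S.
Proof.
apply/setP => i; rewrite desR_invset w1S_invset lo_hi_ltn -desR_invset desR_w0S.
by rewrite inE negbK.
Qed.

(** The pairs left in order by [w1S S] are joined by runs of indices outside [S], along which [z]
    increases. *)
Lemma leL_w1S S z : leL z (w1S S) = (desR z \subset S).
Proof.
apply/idP/idP => [/leL_desR|/subsetP zS]; first by rewrite desR_w1S.
rewrite leLP; apply/subsetP => -[a b]; rewrite w1S_invset (mem_invset z).
case/andP=> ab zba; rewrite ab; apply: contraL zba => /w0S_invset[_ h].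
rewrite -leqNgt ltnW //; apply: increasing_run => // i /h.
by rewrite inE; apply: contra => /zS.
Qed.

Lemma mem_interval S z : (z \in intervalL (w0S S) (w1S S)) = (desR z == S).
Proof. by rewrite inE leL_w0S leL_w1S eqEsubset andbC. Qed.

(** Conjugation by [w0] sends [sgen i] to [sgen (rev_ord i)]. The conjugate of [S] is the left
    descent set of [w1S S], the T of the overview. *)
Definition conjw0 S : {set 'I_n.-1} := [set i | rev_ord i \in S].

Lemma desL_w1S S : desL (w1S S) = conjw0 S.
Proof. by apply/setP => i; rewrite desL_Mw0 desL_w0S !inE negbK. Qed.

Lemma w1SV_w0 S : ((w1S S)^-1 * w0 n)%g \in parab (~: conjw0 S).
Proof.
rewrite /w1S /pmul invMg w0V -{1}w0V -mulgA -[X in X \in _]/(_ ^ _)%g.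
have : (w0S (~: S))^-1%g \in parab (~: S) by rewrite groupV w0S_in.
rewrite -(memJ_conjg _ (w0 n)) /parab -genJ; apply/subsetP/genS/subsetP.
move=> _ /imsetP[_ /imsetP[i iS ->] ->]; rewrite sgenJw0; apply/imset_f.
by rewrite !inE rev_ordK -in_setC.
Qed.

End Permutations.

Local Open Scope ring_scope.

(** * Products along reduced words *)

Section HeckeFamily.

Variables (n : nat) (A : pzRingType).
Implicit Types (i j : 'I_n.-1) (s w : 'S_n) (T : {set 'I_n.-1}) (a : 'I_n.-1 -> A).

(** The 0-Hecke relations in an arbitrary ring, so that one theory of words serves both the [pi_i]
    and the [1 - pi_i]. *)
Record hecke_family a : Prop := HeckeFamily {
  hecke_idem : forall i, a i * a i = a i;
  hecke_braid : forall i j, j = i.+1 :> nat -> a i * a j * a i = a j * a i * a j;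
  hecke_comm : forall i j, (i.+1 < j)%N -> a i * a j = a j * a i }.

Fixpoint hword_rec a (k : nat) s : A :=
  if k isn't k'.+1 then 1 else
  if [pick i in desL s] is Some i then a i * hword_rec a k' (s * sgen i)%g else 1.

(* The product of the a_i along a reduced word of s. *)
Definition hword a s : A := hword_rec a (ninv s) s.

Lemma hword1 a : hword a 1%g = 1.
Proof. by rewrite /hword ninv1. Qed.

Lemma sgen_comm i j s : (i.+1 < j)%N -> (s * sgen i * sgen j = s * sgen j * sgen i)%g.
Proof.
move=> ij; rewrite -!mulgA; congr (_ * _)%g; apply/permP => x; apply: val_inj.
by rewrite !permM /= !val_sgen; do !case: eqP => //; lia.
Qed.

Lemma sgen_braid i j s : j = i.+1 :> nat ->
  (s * sgen i * sgen j * sgen i = s * sgen j * sgen i * sgen j)%g.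
Proof.
move=> ij; rewrite -!mulgA; congr (_ * _)%g; apply/permP => x; apply: val_inj.
rewrite !permM /= !val_sgen ij; do !case: eqP => //; lia.
Qed.

Lemma sgenV i : (sgen i)^-1%g = sgen i.
Proof. exact: tpermV. Qed.

Lemma sgen_far i j : (i.+1 < j)%N || (j.+1 < i)%N -> 
  (sgen i (lo j) = lo j) * (sgen i (hi j) = hi j).
Proof.
by move=> ij; split; rewrite tpermD // -val_eqE /=; lia.
Qed.

(** Independence of the reduced word, by induction on length. If the recursion picks [j] and [i] is
    another descent, both words are unfolded down to a common shorter element: by two letters when
    [i] and [j] are far apart, by three when they are adjacent. The commutation or braid relation
    compares the unfolded letters. *)
Lemma hword_desL a s i : hecke_family a -> i \in desL s ->
  hword a s = a i * hword a (s * sgen i)%g.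
Proof.
move=> ha; have [m] := ubnP (ninv s); elim: m s i => // m IH s i lm si.
have n0 := ninv_desL_gt0 si.
have [j sj ->] : exists2 j, j \in desL s & hword a s = a j * hword a (s * sgen j)%g.
  rewrite {1}/hword; case E: (ninv s) n0 => [//|k] _ /=.
  case: pickP => [j sj|/(_ i)]; last by rewrite si.
  by exists j => //; rewrite /hword ninvMsgen sj E.
clear n0; wlog ij : i j si sj / (i < j)%N.
  move=> H; have [ij|ij|/val_inj->//] := ltngtP i j; first exact: H.
  by apply/esym/H.
have lt (k : 'I_n.-1) (t : 'S_n) : k \in desL t -> (ninv t <= m)%N -> (ninv (t * sgen k)%g < m)%N.
  by move=> tk; have := ninv_desL_gt0 tk; rewrite ninvMsgen tk; lia.
have step (k : 'I_n.-1) (t : 'S_n) : k \in desL t ->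
    (ninv t < m)%N -> hword a t = a k * hword a (t * sgen k)%g.
  by move=> tk tm; apply: IH.
have le (k : 'I_n.-1) (t : 'S_n) : k \in desL t -> (ninv t <= m)%N -> (ninv (t * sgen k)%g <= m)%N.
  by move=> tk tm; apply/ltnW/lt.
have := si; have := sj; rewrite !mem_desL => yj yi.
move: ij; rewrite leq_eqVlt => /orP[/eqP ij|ij].
  have hl : hi i = lo j by apply: val_inj.
  have [j1 j2] : sgen j (lo i) = lo i /\ sgen j (lo j) = hi j.
    by split; rewrite ?tpermL // tpermD // -val_eqE /=; lia.
  have [i1 i2] : sgen i (hi j) = hi j /\ sgen i (lo j) = lo i.
    by split; [rewrite tpermD // -val_eqE /=; lia | rewrite -hl /sgen tpermR].
  have [j3 i3] : sgen j (hi j) = lo j /\ sgen i (lo i) = lo j.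
    by split; rewrite -?hl /sgen ?tpermR ?tpermL.
  rewrite hl in yi; have yij := ltn_trans yj yi.
  have sji : i \in desL (s * sgen j)%g by rewrite mem_desL invMg sgenV !permM hl j1 j2.
  have sij : j \in desL (s * sgen i)%g by rewrite mem_desL invMg sgenV !permM i1 i2.
  have sjij : j \in desL (s * sgen j * sgen i)%g.
    by rewrite mem_desL !invMg !sgenV !permM i1 i2 j3 j1.
  have siji : i \in desL (s * sgen i * sgen j)%g.
    by rewrite mem_desL !invMg !sgenV !permM hl j2 j1 i1 i3.
  rewrite (step i _ sji) ?lt // (step j _ sjij) ?lt ?le //.
  rewrite (step j _ sij) ?lt // (step i _ siji) ?lt ?le //.
  by rewrite !mulrA -(hecke_braid ha (esym ij)) (sgen_braid s (esym ij)).
have far1 : (sgen i (lo j) = lo j) * (sgen i (hi j) = hi j) by apply: sgen_far; rewrite ?ij.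
have far2 : (sgen j (lo i) = lo i) * (sgen j (hi i) = hi i).
  by apply: sgen_far; rewrite ?ij ?orbT.
have sji : i \in desL (s * sgen j)%g by rewrite mem_desL invMg sgenV !permM !far2.
have sij : j \in desL (s * sgen i)%g by rewrite mem_desL invMg sgenV !permM !far1.
rewrite (step i _ sji) ?lt // (step j _ sij) ?lt //.
by rewrite !mulrA (hecke_comm ha ij) (sgen_comm s ij).
Qed.

Lemma hwordL a i s : hecke_family a -> a i * hword a s = hword a (demz i s).
Proof.
move=> ha; rewrite demzE; case: ifPn => si.
  by rewrite (hword_desL ha si) mulrA (hecke_idem ha).
have di : i \in desL (s * sgen i)%g by rewrite desL_sgen.
by rewrite (hword_desL ha di) mulsgenK.
Qed.

Lemma hword_sgen a i : hecke_family a -> hword a (demz i 1%g) = a i.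
Proof. by move=> ha; rewrite -hwordL // hword1 mulr1. Qed.

(** Words are unfolded on the left. The right factor is absorbed by the shorter word, and the first
    letter is put back because left and right Demazure steps commute. *)
Lemma hwordR a j s : hecke_family a -> hword a s * a j = hword a (demzR j s).
Proof.
move=> ha; have [m] := ubnP (ninv s); elim: m s => // m IH s lm.
have [->|/desL_neq0[i si]] := eqVneq s 1%g.
  rewrite hword1 mul1r -[LHS](hword_sgen j ha); congr (hword a _).
  have d1 : j \notin desR (1%g : 'S_n) by rewrite notin_desR !perm1 lo_hi_ltn.
  rewrite demzE desLE invg1 (negPf d1) mul1g.
  by rewrite /demzR (negPf d1) mulg1.
rewrite (hword_desL ha si) -mulrA IH; last first.
  by have := ninv_desL_gt0 si; rewrite ninvMsgen si; lia.
rewrite hwordL // demz_demzR; congr (hword a (demzR _ _)).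
by rewrite demzE desL_sgen si mulsgenK.
Qed.

Lemma hword_ind a (K : A -> Prop) T w : hecke_family a -> K 1 ->
  (forall i x, i \in T -> K x -> K (a i * x)) -> w \in parab T -> K (hword a w).
Proof.
move=> ha K1 Ks; have [m] := ubnP (ninv w); elim: m w => // m IH w lm wT.
have [->|/desL_neq0[i wi]] := eqVneq w 1%g; first by rewrite hword1.
have iT : i \in T by apply: (subsetP (parab_desL wT)).
rewrite (hword_desL ha wi); apply: Ks => //; apply: IH.
  by have := ninv_desL_gt0 wi; rewrite ninvMsgen wi; lia.
by rewrite groupM ?mem_sgen.
Qed.

Lemma hwordL_id a i s : hecke_family a -> i \in desL s -> a i * hword a s = hword a s.
Proof. by move=> ha si; rewrite hwordL // demzE si. Qed.

Lemma hwordR_id a i s : hecke_family a -> i \in desR s -> hword a s * a i = hword a s.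
Proof. by move=> ha si; rewrite hwordR // /demzR si. Qed.

Lemma hecke_family_compl a : hecke_family a -> hecke_family (fun i => 1 - a i).
Proof.
move=> ha; have idem i : (1 - a i) * (1 - a i) = 1 - a i.
  by rewrite mulrBr mulr1 mulrBl mul1r (hecke_idem ha) subrr subr0.
split=> // [i j ij|i j ij]; last first.
  rewrite !mulrBr !mulrBl !mulr1 !mul1r (hecke_comm ha ij) !opprB.
  by rewrite ![_ - _ + _]addrACA [- a i - _]addrC.
(* Apart from the cubic term the expansion is symmetric in [k] and [l], so the braid relation of [a]
   suffices. *)
have E k l : (1 - a k) * (1 - a l) * (1 - a k) =
    1 - a k + (a l * a k + a k * a l + (- (a k * a l * a k) - a l)).
  rewrite -mulrA [X in _ * X]mulrBl mul1r mulrBr idem mulrA [X in X * _]mulrBl mul1r.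
  by rewrite mulrBr mulr1 mulrBl !opprB; congr (_ + _); rewrite addrACA.
rewrite !E (hecke_braid ha ij) [a i * a j + _]addrC; move: (a j * a i + _) (a j * _ * _).
move=> c r; rewrite ![c + _]addrC !addrA; congr (_ + c).
by rewrite -!addrA; congr (1 + _); rewrite addrCA [RHS]addrCA [- a i - _]addrC.
Qed.

(* [deep a k x]: x lies in the span of the words of length > k, expressed through
   the additive functionals killing these words. *)
Definition deep (R : zmodType) a (k : nat) (x : A) : Prop :=
  forall f : A -> R, {morph f : y z / y - z} ->
  (forall w, (k < ninv w)%N -> f (hword a w) = 0) -> f x = 0.

Section Deep.

Variables (R : zmodType) (a : 'I_n.-1 -> A) (k : nat).
Hypothesis ha : hecke_family a.
Local Notation deep := (deep R a k).

Lemma deepB x y : deep x -> deep y -> deep (x - y).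
Proof. by move=> dx dy f fB fw; rewrite fB dx // dy // subr0. Qed.

Lemma deep0 : deep 0.
Proof. by move=> f fB _; rewrite -[X in f X](subrr 0) fB subrr. Qed.

Lemma deep_word w : (k < ninv w)%N -> deep (hword a w).
Proof. by move=> kw f _ fw; apply: fw. Qed.

Lemma deepL i x : deep x -> deep (a i * x).
Proof.
move=> dx f fB fw; apply: (dx (fun y => f (a i * y))) => [y z|w kw].
  by rewrite mulrBr fB.
by rewrite hwordL // fw // (leq_trans kw) // ninv_demz.
Qed.

Lemma deepR i x : deep x -> deep (x * a i).
Proof.
move=> dx f fB fw; apply: (dx (fun y => f (y * a i))) => [y z|w kw].
  by rewrite mulrBl fB.
by rewrite hwordR // fw // (leq_trans kw) // ninv_demzR.
Qed.

End Deep.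

(** In each factor [1 - a i] the term 1 leaves the word of [v] alone, while [- a i] lengthens it
    because [T] avoids the right descents of [v]. Once long, a word stays long under further
    multiplication. *)
Lemma deep_complR (R : zmodType) a T v w : hecke_family a -> [disjoint desR v & T] ->
  w \in parab T ->
  deep R a (ninv v) (hword a v * hword (fun i => 1 - a i) w - hword a v).
Proof.
move=> ha vT; have hb := hecke_family_compl ha.
have dR x : forall y, deep R a (ninv v) y -> x \in parab T ->
    deep R a (ninv v) (y * hword (fun i => 1 - a i) x).
  move=> y dy xT; move: y dy.
  apply: (hword_ind (K := fun z => forall y, deep R a (ninv v) y ->
     deep R a (ninv v) (y * z))) hb _ _ xT => [y|i z _ dz y dy]; first by rewrite mulr1.
  by rewrite mulrA; apply: dz; rewrite mulrBr mulr1; apply: deepB => //; exact: deepR.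
move=> wT; have [m] := ubnP (ninv w); elim: m w wT => // m IH w wT lm.
have [->|/desL_neq0[i wi]] := eqVneq w 1%g; first by rewrite hword1 mulr1 subrr; exact: deep0.
have iT : i \in T by apply: (subsetP (parab_desL wT)).
have wiT : (w * sgen i)%g \in parab T by rewrite groupM ?mem_sgen.
rewrite (hword_desL hb wi) mulrA mulrBr mulr1 mulrBl addrAC; apply: deepB.
  by apply: IH => //; have := ninv_desL_gt0 wi; rewrite ninvMsgen wi; lia.
apply: dR wiT; rewrite hwordR // /demzR.
have vi : i \notin desR v by apply: contraL iT => /(disjointFr vT) ->.
by rewrite (negPf vi); apply: deep_word; rewrite ninv_step -mem_desR (negPf vi).
Qed.

(** The mirror image of [deep_complR] for the complementary family, whose own complements are the
    [a i]. *)
Lemma deep_complL (R : zmodType) a T v w : hecke_family a -> [disjoint desL v & T] ->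
  w \in parab T ->
  deep R (fun i => 1 - a i) (ninv v)
    (hword a w * hword (fun i => 1 - a i) v - hword (fun i => 1 - a i) v).
Proof.
move=> ha vT; have hb := hecke_family_compl ha; set b := fun i => _.
move=> wT; apply: (hword_ind (K := fun z => deep R b (ninv v) (z * hword b v - hword b v)))
  ha _ _ wT => [|i x iT dx]; first by rewrite mul1r subrr; exact: deep0.
have -> : a i * x * hword b v - hword b v =
    (x * hword b v - hword b v) - b i * (x * hword b v - hword b v) - b i * hword b v.
  rewrite -[RHS]addrA -opprD -mulrDr subrK /b mulrBl mul1r opprB [RHS]addrC.
  by rewrite addrA subrK mulrA.
have vi : i \notin desL v by apply: contraL iT => /(disjointFr vT) ->.
apply: deepB; first by apply: deepB => //; exact: deepL.
by rewrite hwordL // demzE (negPf vi); apply: deep_word; rewrite ninvMsgen (negPf vi).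
Qed.

End HeckeFamily.

(** * Linear algebra over H_n(0) *)

Lemma scaler_alg_comm (F : fieldType) (A : algType F) (M : lmodType A)
    (a : F) (h : A) (m : M) :
  h *: (a%:A *: m) = a%:A *: (h *: m).
Proof.
have hC : h * a%:A = a%:A * h by rewrite -scalerAr mulr1 -scalerAl mul1r.
by rewrite !scalerA hC.
Qed.

Section FunctionalExtension.

Variable F : fieldType.

Definition lin_closed (W : lmodType F) (U : W -> Prop) : Prop :=
  U 0 /\ forall (a : F) x y, U x -> U y -> U (a *: x + y).

(** The complement grows along [s]: the next vector [x] is added to [C] unless it already lies in
    [U + C]. *)
Lemma lin_complement (W : lmodType F) (U : W -> Prop) (s : seq W) : lin_closed U ->
  exists C : W -> Prop, [/\ lin_closed C, forall x, U x -> C x -> x = 0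
    & forall x, x \in s -> exists2 u, U u & C (x - u)].
Proof.
move=> [U0 Uc]; elim: s => [|x s [C [[C0 Cc] CU Cs]]].
  exists (fun x => x = 0); split=> //; split=> // a x y -> ->.
  by rewrite scaler0 addr0.
have Us u v : U u -> U v -> U (v - u) by move=> Uu Uv; rewrite addrC -scaleN1r; apply: Uc.
have [[u Uu Cu]|nx] := pselect (exists2 u, U u & C (x - u)).
  by exists C; split=> // y; rewrite inE => /orP[/eqP->|/Cs//]; exists u.
exists (fun y => exists a, C (y - a *: x)); split.
- split=> [|b y z [a Ca] [a' Ca']]; first by exists 0; rewrite scale0r subr0.
  exists (b * a + a'); rewrite (_ : _ - _ = b *: (y - a *: x) + (z - a' *: x)); last first.
    by rewrite scalerBr scalerDl scalerA opprD addrACA.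
  exact: Cc.
- move=> y Uy [a]; have [->|a0] := eqVneq a 0; first by rewrite scale0r subr0; exact: CU.
  (* Dividing by the nonzero [a] would put [x] into [U + C]. *)
  move=> Ca; case: nx; exists (a^-1 *: y).
    by rewrite -[_ *: _]addr0; apply: Uc.
  have := Cc (- a^-1) _ _ Ca C0; rewrite addr0 scalerBr !scaleNr opprK scalerA mulVf //.
  by rewrite scale1r addrC.
- move=> y; rewrite inE => /orP[/eqP->|/Cs[u Uu Cu]].
    by exists 0 => //; exists 1; rewrite subr0 scale1r subrr.
  by exists u => //; exists 0; rewrite scale0r subr0.
Qed.

(** The extension is [f] after the projection onto the image of [g] along a complement. *)
Lemma functional_extension (V W : lmodType F) (g : {linear V -> W}) (f : {linear V -> F^o})
    (s : seq W) :
  injective g -> (forall w, exists c : 'I_(size s) -> F, w = \sum_k c k *: s`_k) ->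
  exists h : {linear W -> F^o}, forall v, h (g v) = f v.
Proof.
move=> gI sW; pose U w := exists v, w = g v.
have [|C [[C0 Cc] CU Cs]] := @lin_complement W U s.
  split=> [|a _ _ [x ->] [y ->]]; first by exists 0; rewrite linear0.
  by exists (a *: x + y); rewrite linearP.
have dec w : {v | C (w - g v)}.
  apply: cid; have [c ->] := sW w.
  apply: (big_ind (fun w => exists v, C (w - g v))).
  - by exists 0; rewrite linear0 subr0.
  - move=> x y [v Cv] [v' Cv']; exists (v + v'); rewrite linearD opprD addrACA.
    by rewrite -[_ - g v]scale1r; apply: Cc.
  move=> k _; have [|_ [v ->] Cv] := Cs s`_k; first exact: mem_nth.
  by exists (c k *: v); rewrite linearZ -scalerBr -[_ *: _]addr0; apply: Cc.
pose p w := sval (dec w).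
have pP w v : C (w - g v) -> p w = v.
  move=> Cv; rewrite /p; case: (dec w) => v' /= Cv'; apply: gI; apply/subr0_eq.
  apply: CU; first by exists (v' - v); rewrite linearB.
  by have := Cc (-1) _ _ Cv' Cv; rewrite scaleN1r opprB addrA subrK.
have pL : linear p.
  move=> a x y; apply: pP; rewrite linearP opprD addrACA -scalerBr.
  by apply: Cc; rewrite /p; [case: (dec x) | case: (dec y)].
pose h w : F^o := f (p w).
have hL : linear h by move=> a x y; rewrite /h pL linearP.
pose hM := GRing.isLinear.Build F W F^o *:%R h hL.
pose hT : {linear W -> F^o} := HB.pack h hM.
exists hT => v; rewrite /= /h; congr (f _); apply: pP; by rewrite subrr.
Qed.

End FunctionalExtension.

Section Hecke0.

Variables (F : fieldType) (n : nat).
Local Notation H := (hecke0 F n).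

Lemma hgen_family : hecke_family (@hgen F n).
Proof.
split=> [i|i j ij|i j ij]; rewrite /GRing.mul /= /hgen !h_mulE; apply/hclE; by constructor.
Qed.

Definition hpi (w : 'S_n) : H := hword (@hgen F n) w.

Lemma hecke0_ind (K : H -> Prop) :
  (forall a, K a%:A) -> (forall i, K (hgen F i)) ->
  (forall x y, K x -> K y -> K (x + y)) -> (forall x y, K x -> K y -> K (x * y)) ->
  forall x, K x.
Proof.
move=> Ka Kg KD KM x; rewrite -(hreprK x); elim: (hrepr x) => [a|i|t IHt u IHu|t IHt u IHu].
- by have := Ka a; rewrite -[a%:A]/(h_scal n a * 1) mulr1.
- exact: Kg.
- by rewrite -h_addE; apply: KD.
- by rewrite -h_mulE; apply: KM.
Qed.

Lemma hecke0_span (x : H) : exists c : 'S_n -> F, x = \sum_w c w *: hpi w.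
Proof.
have single a w0 : exists c : 'S_n -> F, a *: hpi w0 = \sum_w c w *: hpi w.
  exists (fun w => if w == w0 then a else 0); rewrite (bigD1 w0) //= eqxx big1 ?addr0 //.
  by move=> w /negPf->; rewrite scale0r.
(* The span of the [hpi w] contains 1, so it is enough that left multiplication by [x] preserves
   it. *)
suff : forall y, (exists c : 'S_n -> F, y = \sum_w c w *: hpi w) ->
    exists c : 'S_n -> F, x * y = \sum_w c w *: hpi w.
  move/(_ 1); rewrite mulr1; apply; have [c e] := single 1 1%g.
  by exists c; rewrite -e scale1r /hpi hword1.
elim/hecke0_ind: x => [a|i|x y IHx IHy|x y IHx IHy] z [c zc].
- exists (fun w => a * c w); rewrite zc -scalerAl mul1r scaler_sumr.
  by apply: eq_bigr => w _; rewrite scalerA.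
- exists (fun w => \sum_(v | demz i v == w) c v).
  rewrite zc mulr_sumr (eq_bigr (fun w => c w *: hpi (demz i w))); last first.
    by move=> w _; rewrite -scalerAr /hpi (hwordL i w hgen_family).
  rewrite (partition_big (demz i) xpredT) //=; apply: eq_bigr => w _.
  by rewrite scaler_suml; apply: eq_bigr => v /eqP->.
- have [c1 e1] := IHx z (ex_intro _ c zc); have [c2 e2] := IHy z (ex_intro _ c zc).
  exists (fun w => c1 w + c2 w); rewrite mulrDl e1 e2 -big_split; apply: eq_bigr => w _.
  by rewrite scalerDl.
- by rewrite -mulrA; apply: IHx; apply: IHy; exists c.
Qed.

Lemma hecke0_linear (M N : lmodType H) (f : M -> N) :
  (forall x y, f (x + y) = f x + f y) -> (forall (a : F) x, f (a%:A *: x) = a%:A *: f x) ->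
  (forall i x, f (hgen F i *: x) = hgen F i *: f x) -> linear f.
Proof.
move=> fD fa fg h x y; rewrite fD; congr (_ + _).
elim/hecke0_ind: h x => [||h k IHh IHk|h k IHh IHk] x.
- exact: fa.
- exact: fg.
- by rewrite !scalerDl fD IHh IHk.
- by rewrite -!scalerA IHh IHk.
Qed.

End Hecke0.

(* An H-module seen as a vector space over the base field. *)
Definition restr (F : fieldType) (A : lalgType F) (M : lmodType A) : Type := M.

Section Restr.

Variables (F : fieldType) (A : lalgType F) (M : lmodType A).
HB.instance Definition _ := GRing.Zmodule.on (restr M).

Definition restr_scale (a : F) (x : restr M) : restr M := (a%:A : A) *: (x : M).

Fact restr_scaleA a b x : restr_scale a (restr_scale b x) = restr_scale (a * b) x.
Proof. by rewrite /restr_scale scalerA -scalerAl mul1r -scalerA. Qed.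
Fact restr_scale1 : left_id 1 restr_scale.
Proof. by move=> x; rewrite /restr_scale !scale1r. Qed.
Fact restr_scaleDr : right_distributive restr_scale +%R.
Proof. by move=> a x y; rewrite /restr_scale scalerDr. Qed.
Fact restr_scaleDl x : {morph restr_scale^~ x : a b / a + b}.
Proof. by move=> a b; rewrite /restr_scale !scalerDl. Qed.
HB.instance Definition _ := GRing.Zmodule_isLmodule.Build F (restr M)
  restr_scaleA restr_scale1 restr_scaleDr restr_scaleDl.

End Restr.

Section FinGen.

Variables (F : fieldType) (n : nat).
Local Notation H := (hecke0 F n).

(** The [hpi F w] span the algebra, so their products with finitely many generators span the vector
    space. *)
Lemma fin_gen_restr (M : lmodType H) : fin_gen M ->
  exists s : seq (restr M), forall m, exists c : 'I_(size s) -> F, m = \sum_k c k *: s`_k.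
Proof.
move=> [s sM]; pose t : seq (restr M) := [seq hpi F w *: x | w <- enum 'S_n, x <- s].
have tD (x y : restr M) : (exists c : 'I_(size t) -> F, x = \sum_k c k *: t`_k) ->
    (exists c : 'I_(size t) -> F, y = \sum_k c k *: t`_k) ->
    exists c : 'I_(size t) -> F, x + y = \sum_k c k *: t`_k.
  move=> [c ->] [d ->]; exists (fun k => c k + d k); rewrite -big_split.
  by apply: eq_bigr => k _; rewrite scalerDl.
have t0 : exists c : 'I_(size t) -> F, 0 = \sum_k c k *: t`_k.
  by exists (fun=> 0); rewrite big1 // => k _; rewrite scale0r.
exists t => m; have [c ->] := sM m.
apply: (big_ind (fun m : restr M => exists c : 'I_(size t) -> F, m = \sum_k c k *: t`_k)) => //.
move=> k _; have [d ->] := hecke0_span (c k); rewrite scaler_suml.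
apply: (big_ind (fun m : restr M => exists c : 'I_(size t) -> F, m = \sum_k c k *: t`_k)) => //.
move=> w _; have wk : (hpi F w *: s`_k : restr M) \in t.
  by apply: allpairs_f; [exact: mem_enum | exact: mem_nth].
have lt : (index (hpi F w *: s`_k : restr M) t < size t)%N by rewrite index_mem.
exists (fun j => if j == Ordinal lt then d w else 0).
rewrite (bigD1 (Ordinal lt)) //= eqxx nth_index // big1 ?addr0.
  have -> : d w *: hpi F w = (d w)%:A * hpi F w by rewrite -scalerAl mul1r.
  by rewrite -scalerA.
by move=> j /negPf->; rewrite scale0r.
Qed.

End FinGen.

(** * Weak Bruhat interval modules *)

Section IntervalModule.

Variables (F : fieldType) (n : nat) (sigma tau : 'S_n).
Local Notation H := (hecke0 F n).
Local Notation I := {z : 'S_n | z \in intervalL sigma tau}.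
Local Notation V := {ffun I -> F^o}.
Local Notation B := (Bmod F sigma tau).
Implicit Types (i : 'I_n.-1) (x y : 'S_n).

(** Zero outside the interval, so that for labels above [sigma] the generators act simply by [demz],
    even on steps that leave the interval. *)
Definition bv x : B := oapp (@bvec F n sigma tau) 0 (insub x).

Definition bcoord (v : B) x : F := oapp (v : V) 0 (insub x).

Lemma bcoord_val (v : B) (z : I) : bcoord v (val z) = (v : V) z.
Proof. by rewrite /bcoord valK. Qed.

Lemma bcoord_out (v : B) x : x \notin intervalL sigma tau -> bcoord v x = 0.
Proof. by move=> xI; rewrite /bcoord insubN. Qed.

Lemma bv_out x : x \notin intervalL sigma tau -> bv x = 0.
Proof. by move=> xI; rewrite /bv insubN. Qed.

Lemma bcoordD (u v : B) x : bcoord (u + v) x = bcoord u x + bcoord v x.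
Proof. by rewrite /bcoord; case: insubP => /= [z _ _|_]; rewrite ?ffunE ?addr0. Qed.

Lemma bcoordZ (a : F) (v : B) x : bcoord (a%:A *: v) x = a * bcoord v x.
Proof.
by rewrite hscal_act /bcoord; case: insubP => /= [z _ _|_]; rewrite ?ffunE ?mulr0.
Qed.

Lemma bcoord0 x : bcoord 0 x = 0.
Proof. by rewrite -[0](scale0r (0 : B)) -(scale0r (1 : H)) bcoordZ mul0r. Qed.

Lemma bcoordN (v : B) x : bcoord (- v) x = - bcoord v x.
Proof. by apply/eqP; rewrite -addr_eq0 -bcoordD addNr bcoord0. Qed.

Lemma bcoordB (u v : B) x : bcoord (u - v) x = bcoord u x - bcoord v x.
Proof. by rewrite bcoordD bcoordN. Qed.

Lemma bcoord_sum (J : Type) (r : seq J) (v : J -> B) x :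
  bcoord (\sum_(j <- r) v j) x = \sum_(j <- r) bcoord (v j) x.
Proof. by apply: (big_morph (bcoord^~ x)); [move=> u w; exact: bcoordD | exact: bcoord0]. Qed.

Lemma bcoord_inj (u v : B) : (forall x, x \in intervalL sigma tau -> bcoord u x = bcoord v x) ->
  u = v.
Proof.
by move=> uv; apply/ffunP => z; rewrite -!bcoord_val; apply: uv; exact: valP.
Qed.

Lemma bcoord_neq0 (v : B) : v != 0 -> exists x, bcoord v x != 0.
Proof.
move=> v0; apply: contrapT => nx; case/eqP: v0; apply: bcoord_inj => x _; rewrite bcoord0.
by apply: contrapT => cx; apply: nx; exists x; apply/eqP.
Qed.

Lemma bcoord_neq0_in (v : B) x : bcoord v x != 0 -> x \in intervalL sigma tau.
Proof. by apply: contraNT => /bcoord_out ->. Qed.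

Lemma bcoord_bv x y : bcoord (bv x) y = ((y == x) && (x \in intervalL sigma tau))%:R.
Proof.
have [xI|xI] := boolP (x \in intervalL sigma tau); last first.
  by rewrite bv_out // bcoord0 andbF.
rewrite andbT /bv insubT /= /bcoord; case: insubP => /= [z _ <-|yI].
  by rewrite ffunE -val_eqE.
by rewrite (_ : y == x = false) //; apply: contraNF yI => /eqP->.
Qed.

Lemma bv_sum (v : B) : v = \sum_(z : I) (bcoord v (val z))%:A *: bv (val z).
Proof.
apply: bcoord_inj => x xI; rewrite bcoord_sum (bigD1 (Sub x xI)) //= bcoordZ bcoord_bv eqxx xI.
rewrite mulr1 big1 ?addr0 // => z zx; rewrite bcoordZ bcoord_bv.
have /negPf-> : x != val z by apply: contra zx => /eqP e; rewrite -val_eqE /= -e.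
by rewrite mulr0.
Qed.

(** Only the basis vectors of [x] and of [x * sgen i] can be sent to that of [x], and only if [i] is
    a left descent of [x]. *)
Lemma bcoord_hgen i (v : B) x : x \in intervalL sigma tau ->
  bcoord (hgen F i *: v) x =
  if i \in desL x then bcoord v x + bcoord v (x * sgen i)%g else 0.
Proof.
move=> xI; pose X : I := Sub x xI; have Xx : val X = x by [].
rewrite -{1}Xx bcoord_val hgen_act /= /pi_op sum_ffunE.
have E (z : I) : pi_basis F i z X =
    if i \in desL (val z) then (X == z)%:R else (x == val z * sgen i)%g%:R.
  rewrite /pi_basis; case: ifP => _; first by rewrite ffunE.
  case: insubP => /= [z' _ e|xN]; last first.
    by rewrite ffunE; case: eqP => // e; rewrite -[pmul _ _]/(_ * _)%g -e xI in xN.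
  rewrite ffunE -[in RHS]Xx -[(_ * sgen i)%g]/(pmul (sgen i) (val z)).
  by rewrite -e (inj_eq val_inj).
rewrite (eq_bigr (fun z => (v : V) z * (if i \in desL (val z) then (X == z)%:R
    else (x == val z * sgen i)%g%:R))); last by move=> z _; rewrite ffunE E.
case: ifP => xi; last first.
  rewrite big1 // => z _; case: ifP => zi.
    by case: eqP zi => [<-|_ _]; rewrite ?mulr0 // SubK xi.
  by case: eqP xi => [->|_ _]; rewrite ?mulr0 // desL_sgen zi.
rewrite (bigD1 X) //= xi eqxx mulr1; congr (_ + _); first by rewrite -bcoord_val.
have [sI|sI] := boolP ((x * sgen i)%g \in intervalL sigma tau); last first.
  rewrite bcoord_out // big1 // => z zX; case: ifP => zi.
    by rewrite eq_sym (negPf zX) mulr0.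
  case: eqP => [e|_]; rewrite ?mulr0 //; move: sI; rewrite e mulsgenK.
  by rewrite (valP z).
have nx : Sub (x * sgen i)%g sI != X.
  rewrite -val_eqE /=; apply/eqP => e; have := desL_sgen i x.
  by rewrite e xi.
rewrite (bigD1 (Sub (x * sgen i)%g sI)) //= desL_sgen xi /= mulsgenK eqxx mulr1.
rewrite big1 ?addr0; first by rewrite -bcoord_val.
move=> z /andP[zX zs]; case: ifP => zi; first by rewrite eq_sym (negPf zX) mulr0.
case: eqP => [e|_]; rewrite ?mulr0 //; move: zs; rewrite -val_eqE /= e mulsgenK.
by rewrite eqxx.
Qed.

Lemma mem_intervalL x : (x \in intervalL sigma tau) = leL sigma x && leL x tau.
Proof. by rewrite inE. Qed.

Lemma hgen_bv i x : leL sigma x -> hgen F i *: bv x = bv (demz i x).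
Proof.
move=> sx; have [xI|xI] := boolP (x \in intervalL sigma tau); last first.
  rewrite !bv_out ?scaler0 //; apply: contra xI; rewrite !mem_intervalL sx => /andP[_] /=.
  exact/leL_trans/leL_demz.
have -> : bv x = bvec F (Sub x xI : I) by rewrite /bv insubT.
rewrite hgen_bvec /pi_basis demzE SubK; case: ifP => // _.
by rewrite /bv insubT.
Qed.

(** Each cover on the way up from [sigma] prepends one letter to the word; in particular [bv sigma]
    generates the module. *)
Lemma hpi_bv x : leL sigma x -> hpi F sigma *: bv sigma = bv sigma ->
  hpi F x *: bv sigma = bv x.
Proof.
move=> sx s0; apply: (leL_ind (K := fun x => hpi F x *: bv sigma = bv x)) s0 _ sx.
move=> z i sz zi IH; have di : i \in desL (z * sgen i)%g by rewrite desL_sgen.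
rewrite /hpi (hword_desL (@hgen_family F n) di).
by rewrite mulsgenK -scalerA IH hgen_bv // demzE (negPf zi).
Qed.

Lemma Bmod_lift (M : lmodType H) (e : 'S_n -> M) :
  (forall i x, x \in intervalL sigma tau -> hgen F i *: e x =
     if i \in desL x then e x else
     if (x * sgen i)%g \in intervalL sigma tau then e (x * sgen i)%g else 0) ->
  exists f : {linear B -> M}, forall v : B, f v = \sum_(z : I) (bcoord v (val z))%:A *: e (val z).
Proof.
move=> eg; pose f (v : B) : M := \sum_(z : I) (bcoord v (val z))%:A *: e (val z).
have fD u v : f (u + v) = f u + f v.
  rewrite -big_split; apply: eq_bigr => z _ /=.
  by rewrite bcoordD !scalerDl.
have fZ (a : F) v : f (a%:A *: v) = a%:A *: f v.
  by rewrite scaler_sumr; apply: eq_bigr => z _; rewrite bcoordZ scalerA -scalerAl mul1r scalerA.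
have f0 : f 0 = 0 by apply: (addrI (f 0)); rewrite -fD !addr0.
have fb x : x \in intervalL sigma tau -> f (bv x) = e x.
  move=> xI; rewrite /f (bigD1 (Sub x xI)) //= bcoord_bv eqxx xI /= !scale1r.
  rewrite big1 ?addr0 // => z zx; rewrite bcoord_bv.
  have /negPf-> : val z != x by apply: contra zx => /eqP e'; rewrite -val_eqE /= e'.
  by rewrite !scale0r.
have fg i v : f (hgen F i *: v) = hgen F i *: f v.
  rewrite {1}[v]bv_sum scaler_sumr (big_morph f fD f0) scaler_sumr; apply: eq_bigr => z _.
  rewrite !scaler_alg_comm fZ; congr (_ *: _); rewrite hgen_bv; last first.
    by have := valP z; rewrite mem_intervalL => /andP[].
  rewrite eg ?(valP z) // demzE; case: ifP => _; first by rewrite fb // (valP z).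
  by case: ifPn => sI; [rewrite fb | rewrite bv_out].
have fl := hecke0_linear fD fZ fg.
pose fM := GRing.isLinear.Build H B M *:%R f fl.
by exists (HB.pack f fM : {linear B -> M}).
Qed.

(** Builds a homomorphism into the interval module from its coordinates: the condition on [e] is the
    formula of [bcoord_hgen]. *)
Lemma Bmod_colift (M : lmodType H) (e : 'S_n -> M -> F) :
  (forall x u v, e x (u + v) = e x u + e x v) ->
  (forall x (a : F) v, e x (a%:A *: v) = a * e x v) ->
  (forall i x v, x \in intervalL sigma tau -> e x (hgen F i *: v) =
     if i \in desL x then
       e x v + (if (x * sgen i)%g \in intervalL sigma tau then e (x * sgen i)%g v else 0)
     else 0) ->
  exists f : {linear M -> B}, forall v x, x \in intervalL sigma tau -> bcoord (f v) x = e x v.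
Proof.
move=> eD eZ eg; pose f (v : M) : B := [ffun z : I => e (val z) v : F^o].
have cf v x : x \in intervalL sigma tau -> bcoord (f v) x = e x v.
  by move=> xI; rewrite /bcoord insubT /= ffunE.
have fl : linear f.
  apply: hecke0_linear => [u v|a v|i v]; apply: bcoord_inj => x xI.
  - by rewrite bcoordD !cf.
  - by rewrite bcoordZ !cf.
  - rewrite bcoord_hgen // ![bcoord _ x]cf // eg //; case: ifP => // _; congr (_ + _).
    by case: ifPn => sI; [rewrite cf | rewrite bcoord_out].
pose fM := GRing.isLinear.Build H M B *:%R f fl.
by exists (HB.pack f fM : {linear M -> B}).
Qed.

(** By finite dimension the underlying [F]-linear map is bijective, and the inverse of a module
    homomorphism is again one. *)
Lemma Bmod_inverse (f : {linear B -> B}) : injective f ->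
  exists f' : {linear B -> B}, cancel f f' /\ cancel f' f.
Proof.
move=> fI; pose g : V -> V := f.
have gl : linear g.
  by move=> a u v; rewrite /g -(hscal_act a (u : B)) -[_ + _]/(_ *: (u : B) + (v : B))
     linearP hscal_act.
pose gM := GRing.isLinear.Build F V V *:%R g gl.
pose gT : {linear V -> V} := HB.pack g gM.
have kg : lker (linfun gT) == 0%VS.
  by apply/lker0P => u v; rewrite !lfunE /= /g => /fI.
pose h : B -> B := fun v => ((linfun gT)^-1%VF (v : V)).
have fh : cancel f h.
  by move=> v; rewrite /h -[f v]/(gT v) -(lfunE gT) lker0_lfunK.
have hf : cancel h f.
  by move=> v; rewrite -[LHS]/(gT (h v)) -(lfunE gT) /h lker0_lfunVK.
have hl : linear h.
  by move=> a u v; apply: fI; rewrite hf linearP !hf.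
pose hM := GRing.isLinear.Build H B B *:%R h hl.
by exists (HB.pack h hM : {linear B -> B}).
Qed.

Lemma fin_gen_Bmod : fin_gen B.
Proof.
exists [seq bv x | x <- enum 'S_n] => v; pose s := [seq bv x | x <- enum 'S_n].
have nE k : (k < size s)%N -> s`_k = bv (nth 1%g (enum 'S_n) k).
  by rewrite size_map => ks; rewrite (nth_map 1%g).
exists (fun k => (bcoord v (nth 1%g (enum 'S_n) k))%:A); apply: bcoord_inj => x xI.
rewrite bcoord_sum; have kx : (index x (enum 'S_n) < size s)%N.
  by rewrite size_map index_mem mem_enum.
rewrite (bigD1 (Ordinal kx)) //= nE // nth_index ?mem_enum // bcoordZ bcoord_bv eqxx xI.
rewrite mulr1 big1 ?addr0 // => k nk; rewrite nE // bcoordZ bcoord_bv.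
suff /negPf-> : x != nth 1%g (enum 'S_n) k by rewrite mulr0.
apply: contra nk => /eqP xk; rewrite -val_eqE /= xk index_uniq ?enum_uniq //.
by rewrite (leq_trans (ltn_ord k)) // size_map.
Qed.

End IntervalModule.

(** * The module of a descent class *)

Lemma linear_injective (A : pzRingType) (M N : lmodType A) (f : {linear M -> N}) :
  (forall v, v != 0 -> f v != 0) -> injective f.
Proof.
move=> f0 u v fuv; apply/eqP; rewrite -subr_eq0; apply: contraT => /f0.
by rewrite linearB fuv subrr eqxx.
Qed.

Section DescentClassModule.

Variables (F : fieldType) (n : nat) (S : {set 'I_n.-1}).
Local Notation H := (hecke0 F n).
Local Notation sigma := (w0S S).
Local Notation tau := (w1S S).
Local Notation I := {z : 'S_n | z \in intervalL sigma tau}.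
Local Notation P := (Bmod F sigma tau).
Local Notation T := (conjw0 S).
Local Notation w0 := (w0 n).
Implicit Types (i j : 'I_n.-1) (w x y : 'S_n).

Local Notation g := (@hgen F n).
Local Notation bv := (@bv F n sigma tau).

Definition hgenC i : H := 1 - hgen F i.

Definition hpiC w : H := hword hgenC w.

Lemma hgenC_family : hecke_family hgenC.
Proof. exact: hecke_family_compl (@hgen_family F n). Qed.

Lemma hgen_hgenC i : g i * hgenC i = 0.
Proof. by rewrite mulrBr mulr1 (hecke_idem (@hgen_family F n)) subrr. Qed.

(** The first word can end with [pi_i] and the second can start with [1 - pi_i]. *)
Lemma hpi_hpiC i x y : i \in desR x -> i \in desL y -> hpi F x * hpiC y = 0.
Proof.
move=> xi yi; rewrite /hpi -(hwordR_id (@hgen_family F n) xi).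
rewrite /hpiC -(hwordL_id hgenC_family yi) -mulrA [g i * _]mulrA hgen_hgenC.
by rewrite mul0r mulr0.
Qed.

Lemma tau_in : tau \in intervalL sigma tau.
Proof. by rewrite mem_interval desR_w1S. Qed.

Lemma hgen_sigma i : i \in S -> g i *: bv sigma = bv sigma.
Proof. by move=> iS; rewrite hgen_bv ?leL_refl // demzE desL_w0S iS. Qed.

Lemma hpi_sigma : hpi F sigma *: bv sigma = bv sigma.
Proof.
apply: (hword_ind (K := fun h : H => h *: bv sigma = bv sigma)) (@hgen_family F n) _ _ (w0S_in S).
  by rewrite scale1r.
by move=> i x iS xs; rewrite -scalerA xs hgen_sigma.
Qed.

(** Generators with index in [S] fix [bv sigma], so [w] can be lengthened on the right until its
    right descents contain [S]. It is then above [sigma], where [hpi_bv] applies; [bv w'] may still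
    be zero. *)
Lemma hpi_word_sigma w :
  exists2 w', (ninv w <= ninv w')%N & hpi F w *: bv sigma = bv w'.
Proof.
have [|w' [e lw Sw]] := @demzR_saturate n
    (fun w' => hpi F w' *: bv sigma = hpi F w *: bv sigma) S w _ erefl.
  by move=> i x iS <-; rewrite /hpi -(hwordR i x (@hgen_family F n)) -scalerA hgen_sigma.
by exists w'; rewrite // -e hpi_bv ?leL_w0S // hpi_sigma.
Qed.

Lemma descent_lost x y : x \in intervalL sigma tau -> leL x y ->
  y \notin intervalL sigma tau -> exists2 j, j \in desR y & j \notin S.
Proof.
rewrite !mem_interval => /eqP xS /leL_desR; rewrite xS eqEsubset => ->.
by rewrite andbT => /subsetPn.
Qed.

(** * Homomorphisms out of P and projectivity *)

Section Lift.

Variables (M : lmodType H) (m : M).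

Lemma Bmod_lift_elt : exists f : {linear P -> M}, forall v : P,
  f v = \sum_(z : I) (bcoord v (val z))%:A *: (hpi F (val z) *: (hpiC (w0S (~: S)) *: m)).
Proof.
apply: (Bmod_lift (e := fun x => hpi F x *: (hpiC (w0S (~: S)) *: m))) => i x xI.
rewrite scalerA /hpi hwordL; last exact: hgen_family.
rewrite demzE; case: ifPn => // xi; case: ifPn => // yI.
have [j yj jS] := descent_lost xI (leL_sgen xi) yI.
by rewrite scalerA (hpi_hpiC yj) ?scale0r // desL_w0S inE.
Qed.

End Lift.

(** The coordinate is read at a shortest element [x] of the support. By [deep_complR], each basis
    vector in the support is sent to itself up to words that act on [bv sigma] as labels longer than
    [x]. *)
Lemma Bmod_lift_bottom_inj (f : {linear P -> P}) :
  (forall v : P, f v = \sum_(z : I) (bcoord v (val z))%:A *: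
     (hpi F (val z) *: (hpiC (w0S (~: S)) *: bv sigma))) -> injective f.
Proof.
move=> fE; apply: linear_injective => v /bcoord_neq0[x0 x0v].
case: (@arg_minnP _ x0 (fun x => bcoord v x != 0) (@ninv n) x0v) => x xv xmin.
have xI := bcoord_neq0_in xv.
apply/eqP => /(congr1 (fun v : P => bcoord v x)); rewrite bcoord0 fE bcoord_sum.
rewrite (eq_bigr (fun z : I => bcoord v (val z) * bcoord (bv (val z)) x)); last first.
  move=> z _; rewrite bcoordZ; have [->|vz] := eqVneq (bcoord v (val z)) 0.
    by rewrite !mul0r.
  congr (_ * _); have zI := valP z; have := zI; rewrite mem_interval => /eqP zS.
  have dz : [disjoint desR (val z) & ~: S] by rewrite zS disjoints_subset setCK.
  have := @deep_complR n H F (@hgen F n) _ (val z) _ (@hgen_family F n) dz (w0S_in (~: S)).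
  move/(_ (fun h => bcoord (h *: bv sigma) x)); rewrite scalerBl bcoordB scalerA.
  have zs : leL sigma (val z) by rewrite leL_w0S zS.
  rewrite -/(hpi F (val z)) [hpi F (val z) *: bv sigma]hpi_bv ?hpi_sigma //.
  move=> h; apply/eqP; rewrite -subr_eq0; apply/eqP; apply: h.
    by move=> h k; rewrite scalerBl bcoordB.
  move=> w zw; have [w' lw e] := hpi_word_sigma w; rewrite -/(hpi F w) e bcoord_bv.
  case: eqP => [xw|]; rewrite // -xw in lw.
  by have := xmin _ vz; rewrite leqNgt (leq_trans zw lw).
rewrite (bigD1 (Sub x xI)) //= bcoord_bv eqxx xI mulr1 big1 ?addr0 => [|z zx].
  by move/eqP; rewrite (negPf xv).
rewrite bcoord_bv (_ : x == val z = false) ?mulr0 //.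
by apply: contraNF zx => /eqP e; rewrite -val_eqE /= -e.
Qed.

Lemma projective_Bmod : projective P.
Proof.
move=> M N p h p_surj; have [f fE] := Bmod_lift_elt (bv sigma).
have [f' [fK f'K]] := Bmod_inverse (Bmod_lift_bottom_inj fE).
(* The twist by [f'] compensates [f]: the homomorphism attached to [x], followed by [p], is [h]
   after [f'] after [f]. *)
have [x xE] := p_surj (h (f' (bv sigma))); have [k kE] := Bmod_lift_elt x.
exists k => v; rewrite kE linear_sum -[v in RHS]fK fE !linear_sum.
by apply: eq_bigr => z _; rewrite !linearZ xE.
Qed.

(** * Homomorphisms into P and injectivity *)

Section Colift.

Variables (M : lmodType H) (l : {linear restr M -> F^o}).

(** Right multiplication by [pi_i] kills the word of [x^-1 * w0] if [i] is no left descent of [x];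
    otherwise it gives the difference of the words attached to [x] and to [x * sgen i]. The sign
    turns this difference into the sum that [Bmod_colift] asks for. *)
Lemma Bmod_colift_functional : exists f : {linear M -> P},
  forall v x, x \in intervalL sigma tau ->
  bcoord (f v) x = (-1) ^+ ninv x * l ((hpi F (w0S T) * hpiC (x^-1 * w0)%g) *: v).
Proof.
apply: (Bmod_colift (e := fun x v =>
  (-1) ^+ ninv x * l ((hpi F (w0S T) * hpiC (x^-1 * w0)%g) *: v))).
- by move=> x u v; rewrite -mulrDr scalerDr linearD.
- move=> x a v; rewrite mulrCA; congr (_ * _); move: (_ * hpiC _) => h.
  have lZ (u : restr M) : l (a *: u) = a * l u by rewrite linearZ.
  by rewrite -lZ scaler_alg_comm.
move=> i x v xI; rewrite scalerA -mulrA.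
have -> : hpiC (x^-1 * w0)%g * g i = hpiC (x^-1 * w0)%g - hpiC (demzR i (x^-1 * w0)%g).
  by rewrite /hpiC -(hwordR i _ hgenC_family) mulrBr mulr1 subKr.
rewrite /demzR desR_Mw0 -desLE; have [xi|xi] := boolP (i \in desL x); last first.
  by rewrite subrr mulr0 scale0r linear0 mulr0.
have -> : (sgen i * (x^-1 * w0) = (x * sgen i)^-1 * w0)%g.
  by rewrite invMg sgenV mulgA.
rewrite mulrBr scalerBl linearB mulrBr; congr (_ + _).
rewrite ninvMsgen xi -mulrN1 mulrAC -exprSr.
have [nx|] := boolP (ninv x == 0%N); first by have := ninv_desL_gt0 xi; rewrite (eqP nx).
rewrite -lt0n => nx; case: ifPn => yI.
  by rewrite -{1}(prednK nx) !exprS !mulN1r opprK.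
have yx : leL (x * sgen i)%g x by rewrite -{2}(mulsgenK i x) leL_sgen // desL_sgen negbK.
(* A step down leaves the class by losing a right descent [j] in [S]. Then [rev_ord j] is a right
   descent of [w0S T] and a left descent of the other word, so the product vanishes. *)
have [j jS yj] : exists2 j, j \in S & j \notin desR (x * sgen i)%g.
  apply/subsetPn; apply: contra yI => Sy; rewrite mem_interval eqEsubset Sy andbT.
  by have := xI; rewrite mem_interval => /eqP <-; exact: leL_desR.
rewrite (@hpi_hpiC (rev_ord j)) ?scale0r ?linear0 ?mulr0 //.
  by rewrite desR_w0S inE rev_ordK.
by rewrite desL_Mw0 rev_ordK -desRE.
Qed.

End Colift.

(** Outside the interval [x] is not above [sigma], nor is the element below it, so both sides
    vanish. *)
Lemma bcoord_hgenC i (v : P) x : leL x tau ->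
  bcoord (hgenC i *: v) x = if i \in desL x then - bcoord v (x * sgen i)%g else bcoord v x.
Proof.
move=> xt; rewrite scalerBl scale1r bcoordB; have [xI|xI] := boolP (x \in intervalL sigma tau).
  rewrite bcoord_hgen //; case: ifP => _; last by rewrite subr0.
  by rewrite opprD addNKr.
rewrite !(bcoord_out _ xI) subr0; case: ifPn => // xi; rewrite bcoord_out ?oppr0 //.
apply: contra xI; rewrite !mem_intervalL xt andbT => /andP[sx _]; apply: leL_trans sx _.
by rewrite -{2}(mulsgenK i x) leL_sgen // desL_sgen negbK.
Qed.

(** At [tau] the word has letters outside [T], which preserve the coordinate at [tau]. Each step
    down appends a letter [1 - pi_i], which moves the coordinate being read one step down and
    changes its sign. *)
Lemma bcoord_hpiC_below x : leL x tau -> forall v : P,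
  bcoord (hpiC (x^-1 * w0)%g *: v) tau = (-1) ^+ (ninv x + ninv tau) * bcoord v x.
Proof.
apply: (leL_ind_down (K := fun x => forall v : P,
  bcoord (hpiC (x^-1 * w0)%g *: v) tau = (-1) ^+ (ninv x + ninv tau) * bcoord v x)).
  move=> v; rewrite addnn -mul2n exprM sqrrN !expr1n mul1r.
  move: v; apply: (hword_ind (K := fun h : H => forall v : P, bcoord (h *: v) tau = bcoord v tau))
    hgenC_family _ _ (w1SV_w0 S) => [v|i h iT hv v]; first by rewrite scale1r.
  by rewrite -scalerA bcoord_hgenC ?leL_refl // desL_w1S -if_neg -in_setC iT.
move=> z i zt zi IH v.
have e : hpiC ((z * sgen i)^-1 * w0)%g = hpiC (z^-1 * w0)%g * hgenC i.
  rewrite /hpiC (hwordR i _ hgenC_family) /demzR desR_Mw0 -desLE zi /=.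
  by rewrite invMg sgenV mulgA.
rewrite e -scalerA IH bcoord_hgenC // zi mulrN -mulNr ninvMsgen zi.
by rewrite -{1}(prednK (ninv_desL_gt0 zi)) addSn exprS mulN1r opprK.
Qed.

(** Letters outside [T] prepended to [w] do not affect the coordinate at [tau], so [w] can be
    lengthened until it has the form [y^-1 * w0] with [y] below [tau]. *)
Lemma bcoord_hpiC_tau w : exists2 y, (ninv y + ninv w <= ninv w0)%N &
  exists k, forall v : P, bcoord (hpiC w *: v) tau = (-1) ^+ k * bcoord v y.
Proof.
have [|//|w' [e lw Tw]] := @demz_saturate n
    (fun w' => forall v : P, bcoord (hpiC w' *: v) tau = bcoord (hpiC w *: v) tau) (~: T) w.
  move=> i x; rewrite inE => iT xv v; rewrite -xv /hpiC -(hwordL i x hgenC_family) -scalerA.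
  by rewrite bcoord_hgenC ?leL_refl // desL_w1S (negPf iT).
pose y := (w' * w0)^-1%g.
have yw : (y^-1 * w0 = w')%g by rewrite /y invgK -mulgA w0K mulg1.
have yt : leL y tau.
  rewrite leL_w1S desRE invgK; apply/subsetP => i; rewrite desL_Mw0 => iw.
  have : rev_ord i \in T by apply: contraNT iw => iT; apply: (subsetP Tw); rewrite inE.
  by rewrite inE rev_ordK.
exists y; first by rewrite ninvV -(ninvMw0 w') leq_add2l.
by exists (ninv y + ninv tau)%N => v; rewrite -e -yw bcoord_hpiC_below.
Qed.

(** Take [x] shortest in the support. By [deep_complL] the factor [hpi F (w0S T)] acts trivially up
    to longer words, which read coordinates of [v] at elements shorter than [x], hence zero. *)
Lemma bcoord_tau_separates (v : P) : v != 0 -> exists2 x, x \in intervalL sigma tau &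
  bcoord ((hpi F (w0S T) * hpiC (x^-1 * w0)%g) *: v) tau != 0.
Proof.
case/bcoord_neq0=> x0 x0v.
case: (@arg_minnP _ x0 (fun x => bcoord v x != 0) (@ninv n) x0v) => x xv xmin.
have xI := bcoord_neq0_in xv; exists x => //.
have xS : desR x = S by apply/eqP; rewrite -mem_interval.
have dx : [disjoint desL (x^-1 * w0)%g & T].
  by rewrite disjoints_subset; apply/subsetP => i; rewrite desL_Mw0 -desRE xS !inE.
have := @deep_complL n H F (@hgen F n) _ _ _ (@hgen_family F n) dx (w0S_in T).
move/(_ (fun h => bcoord (h *: v) tau)); rewrite scalerBl bcoordB => h.
have /eqP : bcoord ((hpi F (w0S T) * hpiC (x^-1 * w0)%g) *: v) tau
    - bcoord (hpiC (x^-1 * w0)%g *: v) tau = 0.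
  apply: h => [h k|w xw]; first by rewrite scalerBl bcoordB.
  have [y yw [k yv]] := bcoord_hpiC_tau w; rewrite -/(hpiC w) yv.
  suff /eqP -> : bcoord v y == 0 by rewrite mulr0.
  have lyx : (ninv y < ninv x)%N.
    move: (ninvMw0 x^-1%g) xw yw; rewrite ninvV.
    by move: (ninv _) (ninv w) (ninv y) (ninv w0) (ninv x) => a b c d e; lia.
  by apply: contraT => /xmin; rewrite leqNgt lyx.
rewrite subr_eq0 => /eqP ->; rewrite bcoord_hpiC_below ?leL_w1S ?xS //.
by rewrite mulf_neq0 // signr_eq0.
Qed.

Definition bcoord_tau (v : restr P) : F^o := bcoord (v : P) tau.

Fact bcoord_tau_linear : linear bcoord_tau.
Proof. by move=> a u v; rewrite /bcoord_tau bcoordD bcoordZ. Qed.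
HB.instance Definition _ := GRing.isLinear.Build F (restr P) F^o *:%R bcoord_tau bcoord_tau_linear.

Lemma Bmod_colift_top_inj (f : {linear P -> P}) :
  (forall v x, x \in intervalL sigma tau -> bcoord (f v) x =
     (-1) ^+ ninv x * bcoord ((hpi F (w0S T) * hpiC (x^-1 * w0)%g) *: v) tau) -> injective f.
Proof.
move=> fE; apply: linear_injective => v /bcoord_tau_separates[x xI xv].
apply/eqP => /(congr1 (fun v : P => bcoord v x)); rewrite bcoord0 fE // => /eqP.
by rewrite mulf_eq0 signr_eq0 (negPf xv).
Qed.

(** The functional [bcoord_tau] yields an automorphism [f], so [h] is recovered, up to [f], from its
    composite with [bcoord_tau]. Extending that functional along [p] therefore extends [h]. *)
Lemma injective_fg_Bmod : injective_fg P.
Proof.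
move=> M N _ fN p h pI.
have [f fE] := Bmod_colift_functional bcoord_tau.
have [f' [fK f'K]] := Bmod_inverse (Bmod_colift_top_inj fE).
pose l (m : restr M) : F^o := bcoord (h m) tau.
have lL : linear l by move=> a u v; rewrite /l linearP bcoordD bcoordZ.
pose lM := GRing.isLinear.Build F (restr M) F^o *:%R l lL.
pose lT : {linear restr M -> F^o} := HB.pack l lM.
pose q (m : restr M) : restr N := p m.
have qL : linear q by move=> a u v; rewrite /q linearP.
pose qM := GRing.isLinear.Build F (restr M) (restr N) *:%R q qL.
pose qT : {linear restr M -> restr N} := HB.pack q qM.
have [s sN] := fin_gen_restr fN.
have [mu muE] := @functional_extension F _ _ qT lT s pI sN.
have [k kE] := Bmod_colift_functional mu.
exists (f' \o k) => m /=; rewrite -[RHS]fK; congr (f' _); apply: bcoord_inj => x xI.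
rewrite kE // fE //; congr (_ * _); rewrite -linearZ.
by rewrite -[mu _]/(mu (qT _)) muE /= /l linearZ.
Qed.

(** * Joint eigenvectors and the smallest nonzero submodule *)

Definition joint_eigen (u : P) := forall i, g i *: u = 0 \/ g i *: u = u.

(** If a longest element [x] of the support is not [tau], some cover [x * sgen i] lies in the
    interval. There [pi_i u] has the nonzero coordinate of [u] at [x], whereas 0 and [u] have
    coordinate 0. *)
Lemma joint_eigen_tau (u : P) : joint_eigen u -> u != 0 -> bcoord u tau != 0.
Proof.
move=> uJ /bcoord_neq0[x0 x0u].
case: (@arg_maxnP _ x0 (fun x => bcoord u x != 0) (@ninv n) x0u) => x xu xmax.
have := bcoord_neq0_in xu; rewrite mem_intervalL => /andP[sx xt].
have [xe|xnt] := eqVneq x tau; first by rewrite xe in xu.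
have [i xi xit] := leL_cover xnt xt.
have xiI : (x * sgen i)%g \in intervalL sigma tau.
  by rewrite mem_intervalL xit (leL_trans sx (leL_sgen xi)).
have xi0 : bcoord u (x * sgen i)%g = 0.
  apply/eqP; apply: contraT => /xmax; rewrite ninvMsgen (negPf xi).
  by move/(leq_trans (ltnSn _)); rewrite ltnn.
have := bcoord_hgen i u xiI; rewrite desL_sgen xi mulsgenK xi0 add0r.
by case: (uJ i) => ->; rewrite ?bcoord0 ?xi0 => /esym/eqP; rewrite (negPf xu).
Qed.

Lemma joint_eigen_word (u : P) w : joint_eigen u -> hpiC w *: u = 0 \/ hpiC w *: u = u.
Proof.
move=> uJ; have wT : w \in parab setT.
  have [m] := ubnP (ninv w); elim: m w => // m IH w lm.
  have [->|/desL_neq0[i wi]] := eqVneq w 1%g; first exact: group1.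
  rewrite -(mulsgenK i w) groupM ?mem_sgen ?inE //; apply: IH.
  by have := ninv_desL_gt0 wi; rewrite ninvMsgen wi; lia.
apply: (hword_ind (K := fun h : H => h *: u = 0 \/ h *: u = u)) hgenC_family _ _ wT.
  by right; rewrite scale1r.
move=> i h _ hu; rewrite -scalerA; case: hu => ->; first by left; rewrite scaler0.
by rewrite scalerBl scale1r; case: (uJ i) => ->; [right; rewrite subr0 | left; rewrite subrr].
Qed.

(** The eigenvalues are forced to be those of [bv tau]. Subtracting a multiple of [bv tau] then
    leaves a joint eigenvector with zero coordinate at [tau], which must vanish. *)
Lemma joint_eigen_bv (u : P) : joint_eigen u -> u = (bcoord u tau)%:A *: bv tau.
Proof.
move=> uJ; have [->|u0] := eqVneq u 0; first by rewrite bcoord0 !scale0r.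
(* The product from [bcoord_tau_separates] does not kill [u], so its right factor fixes [u]; the
   left factor [hpi F (w0S T)] can end with [pi_i], which therefore cannot kill [u]. *)
have uJ_T i : i \in T -> g i *: u = u.
  move=> iT; have [x xI] := bcoord_tau_separates u0.
  rewrite -scalerA; have [->|->] := joint_eigen_word (x^-1 * w0)%g uJ.
    by rewrite scaler0 bcoord0 eqxx.
  case: (uJ i) => // ui; rewrite /hpi -(@hwordR_id _ _ _ i) ?desR_w0S //; last exact: hgen_family.
  by rewrite -scalerA ui scaler0 bcoord0 eqxx.
have uJ_nT i : i \notin T -> g i *: u = 0.
  move=> iT; case: (uJ i) => // ui; have := joint_eigen_tau uJ u0.
  by rewrite -ui bcoord_hgen ?tau_in // desL_w1S (negPf iT) eqxx.
apply/eqP; rewrite -subr_eq0; apply: contraT => /joint_eigen_tau; set v := u - _.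
have -> : bcoord v tau = 0.
  by rewrite bcoordB bcoordZ bcoord_bv eqxx tau_in mulr1 subrr.
suff vJ : joint_eigen v by move=> /(_ vJ); rewrite eqxx.
have tg i : g i *: bv tau = if i \in T then bv tau else 0.
  rewrite hgen_bv; last by have := tau_in; rewrite mem_intervalL => /andP[].
  rewrite demzE desL_w1S; case: ifPn => // iT; apply: bv_out.
  rewrite mem_intervalL negb_and orbC; apply/orP; left; apply/negP => /leL_ninv.
  by rewrite ninvMsgen desL_w1S (negPf iT) ltnn.
move=> i; rewrite scalerBr scaler_alg_comm tg.
by have [iT|iT] := boolP (i \in T); [right; rewrite uJ_T | left; rewrite uJ_nT // scaler0 subr0].
Qed.

Lemma submod_bv_tau (U : {pred P}) (q : P) : submod_closed U -> q \in U -> q != 0 ->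
  bv tau \in U.
Proof.
move=> Uc qU q0; have UZ (h : H) v : v \in U -> h *: v \in U.
  by case: Uc => U0 Ul vU; rewrite -[_ *: _]addr0; exact: Ul.
have q1 : hpi F 1%g *: q != 0 by rewrite /hpi hword1 scale1r.
case: (@arg_maxnP _ 1%g (fun w => hpi F w *: q != 0) (@ninv n) q1) => w wq wmax.
set u := hpi F w *: q in wq.
have uJ : joint_eigen u.
  move=> i; rewrite /u scalerA /hpi (hwordL i w (@hgen_family F n)) demzE.
  case: ifPn => wi; [by right | left; apply/eqP; apply: contraT => /wmax].
  by rewrite ninvMsgen (negPf wi) => /(leq_trans (ltnSn _)); rewrite ltnn.
have ut := joint_eigen_tau uJ wq.
have -> : bv tau = (bcoord u tau)^-1%:A *: u.
  apply: bcoord_inj => x _.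
  have ux : bcoord u x = bcoord u tau * bcoord (bv tau) x.
    by rewrite {1}(joint_eigen_bv uJ) bcoordZ.
  by rewrite bcoordZ ux mulrA mulVf // mul1r.
by rewrite !UZ.
Qed.

Lemma bv_tau_neq0 : bv tau != 0.
Proof.
apply/eqP => /(congr1 (fun v : P => bcoord v tau)); rewrite bcoord0 bcoord_bv eqxx tau_in.
by move/eqP; rewrite oner_eq0.
Qed.

Lemma indecomposable_Bmod : indecomposable P.
Proof.
split=> [|U W Uc Wc _ UW]; first by exists (bv tau); exact: bv_tau_neq0.
have [U0|nU] := pselect (forall m, m \in U -> m = 0); [by left | right].
move=> m mW; apply: contrapT => /eqP m0; apply: nU => q qU; apply: contrapT => /eqP q0.
by have /eqP := UW _ (submod_bv_tau Uc qU q0) (submod_bv_tau Wc mW m0); rewrite (negPf bv_tau_neq0).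
Qed.

Lemma essential_Bmod (X : lmodType H) (f : {linear X -> P}) :
  (exists m, f m != 0) -> essential f.
Proof.
move=> [m fm] U Uc [q qU q0]; pose im : {pred P} := [pred v | `[< exists m, f m = v >]].
have imc : submod_closed im.
  split=> [|h u v]; rewrite !inE; first by apply/asboolP; exists 0; rewrite linear0.
  move=> /asboolP[u' <-] /asboolP[v' <-]; apply/asboolP; exists (h *: u' + v').
  by rewrite linearP.
have fim : f m \in im by rewrite inE; apply/asboolP; exists m.
have := submod_bv_tau imc fim fm; rewrite inE => /asboolP[m' fm'].
by exists m'; rewrite fm' ?bv_tau_neq0 // (submod_bv_tau Uc qU q0).
Qed.

End DescentClassModule.

(** The basis is relabelled by [z |-> u * z]. Equal left descents match the vectors that are fixed,
    and the last hypothesis makes a step out of the first interval also a step out of the descent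
    class. *)
Lemma Bmod_embedding (F : fieldType) n (sigma rho u : 'S_n) (S : {set 'I_n.-1}) :
  (forall z, z \in intervalL sigma rho -> desR (u * z)%g = S) ->
  (forall z, z \in intervalL sigma rho -> desL (u * z)%g = desL z) ->
  (forall z i, z \in intervalL sigma rho -> i \notin desL z ->
     desR (u * (z * sgen i))%g = S -> (z * sgen i)%g \in intervalL sigma rho) ->
  exists f : {linear Bmod F sigma rho -> Bmod F (w0S S) (w1S S)}, injective f.
Proof.
move=> uS uL uI; have inP z : z \in intervalL sigma rho ->
    (u * z)%g \in intervalL (w0S S) (w1S S) by move=> zI; rewrite mem_interval uS.
have [i x xI|f fE] := @Bmod_lift F n sigma rho (Bmod F (w0S S) (w1S S))
    (fun x => bv F (w0S S) (w1S S) (u * x)%g).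
  rewrite hgen_bv ?leL_w0S ?uS // demzE uL //; case: ifPn => // xi.
  case: ifPn => [_|nI]; first by rewrite mulgA.
  by rewrite bv_out // mem_interval -mulgA; apply: contra nI => /eqP; exact: uI.
exists f; apply: linear_injective => v /bcoord_neq0[x xv]; have xI := bcoord_neq0_in xv.
apply/eqP => /(congr1 (fun w : Bmod F (w0S S) (w1S S) => bcoord w (u * x)%g)).
rewrite bcoord0 fE bcoord_sum (bigD1 (Sub x xI)) //= bcoordZ bcoord_bv eqxx inP // mulr1.
rewrite big1 ?addr0 => [|z zx]; first by move/eqP; rewrite (negPf xv).
rewrite bcoordZ bcoord_bv (inj_eq (mulgI u)) (_ : x == val z = false) ?mulr0 //.
by apply: contraNF zx => /eqP e; rewrite -val_eqE /= -e.
Qed.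

(** * Reading orders of diagrams *)

Local Open Scope nat_scope.

Section Sequences.

Variables (A B : eqType).

Lemma pairwise_flatten_map (e : rel A) (r : rel B) (s : seq A) (t : A -> seq B) :
  pairwise e s -> {in s, forall a, pairwise r (t a)} ->
  {in s &, forall a b, e a b -> allrel r (t a) (t b)} ->
  pairwise r (flatten [seq t a | a <- s]).
Proof.
elim: s => //= a s IH /andP[ea es] tp tr; rewrite pairwise_cat tp ?mem_head //=.
apply/andP; split; last first.
  apply: IH => // [b bs|b c bs cs]; first by apply: tp; rewrite inE bs orbT.
  by apply: tr; rewrite inE (bs, cs) orbT.
apply/allrelP => x y xa /flattenP[_ /mapP[b bs ->] yb].
have /allrelP : allrel r (t a) (t b).
  by apply: tr; rewrite ?mem_head ?inE ?bs ?orbT // (allP ea).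
exact.
Qed.

Lemma index_ltn_rel (r : rel B) (s : seq B) p q : transitive r -> irreflexive r ->
  sorted r s -> p \in s -> q \in s ->
  (index p s < index q s) = r p q.
Proof.
move=> rt ri sr ps qs; apply/idP/idP => [|rpq]; first exact: (sorted_ltn_index rt sr _ _ ps qs).
case: ltngtP => // [lqp|/index_inj e].
  by have := rt _ _ _ rpq (sorted_ltn_index rt sr _ _ qs ps lqp); rewrite ri.
by move: rpq; rewrite e // ri.
Qed.

(** Links partial sums of a composition to changes of row or column in a reading order: [key]
    recovers the block of an entry, and since no block is empty every proper partial sum is a change
    of block. *)
Lemma cut_flatten (s : seq A) (t : A -> seq B) (key : B -> A) (x0 : B) (i : nat) :
  uniq s -> {in s, forall a, t a != [::]} -> {in s, forall a, {in t a, forall x, key x = a}} ->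
  i.+1 < size (flatten [seq t a | a <- s]) ->
  (exists2 k, k.+1 < size s & i.+1 = sumn (take k.+1 [seq size (t a) | a <- s])) <->
  key (nth x0 (flatten [seq t a | a <- s]) i) <>
  key (nth x0 (flatten [seq t a | a <- s]) i.+1).
Proof.
elim: s i => //= a s IH i /andP[as_ us] t0 tk; rewrite size_cat !nth_cat => si.
have ta x : x \in t a -> key x = a by apply: tk; rewrite mem_head.
have [ia|ia] := ltnP i (size (t a)); last first.
  have -> : (i.+1 < size (t a)) = false by lia.
  rewrite subSn //; have [|||IH1 IH2] := IH (i - size (t a)) us.
  - by move=> b bs; apply: t0; rewrite inE bs orbT.
  - by move=> b bs; apply: tk; rewrite inE bs orbT.
  - by lia.
  split=> [[[|k] ks]|/IH2[k ks e]].
  - by rewrite take0 /=; lia.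
  - by move=> e; apply: IH1; exists k => //; lia.
  - by exists k.+1 => //; lia.
have [ia'|ia'] := ltnP i.+1 (size (t a)).
  by split=> [[k _]|]; [lia | rewrite !ta ?mem_nth].
rewrite ta ?mem_nth //; case: s us t0 tk si {IH} as_ => [|b s] us t0 tk si as_.
  by move: si; rewrite /= addn0; lia.
have tb : 0 < size (t b) by rewrite lt0n size_eq0 t0 // !inE eqxx orbT.
split=> [_|_]; last by exists 0 => //=; lia.
rewrite (_ : i.+1 - _ = 0) /=; last by lia.
rewrite nth_cat tb (tk b) ?inE ?eqxx ?orbT ?mem_nth //.
by move=> ab; move: as_; rewrite ab mem_head.
Qed.

End Sequences.

Lemma compsetP n (beta : seq nat) (i : 'I_n.-1) :
  reflect (exists2 k, k.+1 < size beta & i.+1 = sumn (take k.+1 beta)) (i \in compset n beta).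
Proof.
rewrite inE; apply: (iffP existsP) => [[k /eqP e]|[k ks e]].
  by exists k => //; have := ltn_ord k; lia.
have k' : k < (size beta).-1 by lia.
by exists (Ordinal k'); apply/eqP.
Qed.

(** The order in which [rb_boxes] lists boxes; the next two definitions do the same for [col_boxes]
    and [rcol_boxes]. *)
Definition rb_lt (p q : nat * nat) := (p.2 < q.2) || (p.2 == q.2) && (q.1 < p.1).
Definition col_lt (p q : nat * nat) := (p.1 < q.1) || (p.1 == q.1) && (p.2 < q.2).
Definition rcol_lt (p q : nat * nat) := (q.1 < p.1) || (p.1 == q.1) && (p.2 < q.2).

Lemma rb_lt_trans : transitive rb_lt.
Proof. by move=> q p r; rewrite /rb_lt; lia. Qed.
Lemma col_lt_trans : transitive col_lt.
Proof. by move=> q p r; rewrite /col_lt; lia. Qed.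
Lemma rcol_lt_trans : transitive rcol_lt.
Proof. by move=> q p r; rewrite /rcol_lt; lia. Qed.
Lemma rb_lt_irr : irreflexive rb_lt.
Proof. by move=> p; rewrite /rb_lt; lia. Qed.
Lemma col_lt_irr : irreflexive col_lt.
Proof. by move=> p; rewrite /col_lt; lia. Qed.
Lemma rcol_lt_irr : irreflexive rcol_lt.
Proof. by move=> p; rewrite /rcol_lt; lia. Qed.

Lemma pairwise_iota m k : pairwise ltn (iota m k).
Proof. by rewrite -sorted_pairwise ?iota_ltn_sorted //; exact: ltn_trans. Qed.

Lemma pairwise_rev_iota m k : pairwise (fun a b => b < a) (rev (iota m k)).
Proof.
rewrite -sorted_pairwise ?rev_sorted ?iota_ltn_sorted // => a b c.
by move=> h1 h2; exact: ltn_trans h2 h1.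
Qed.

Section Diagram.

Variable alpha : seq nat.

Local Notation width := (\max_(a <- alpha) a).

(** Up each column, rightmost column first. Columns of [tcd alpha] may have gaps, hence the
    filter. *)
Definition rcol_boxes : seq (nat * nat) :=
  flatten [seq [seq (j, i) | i <- iota 1 (size alpha) & j <= nth 0 alpha i.-1]
          | j <- rev (iota 1 width)].

Lemma mem_tcd (b : nat * nat) :
  (b \in tcd alpha) = (0 < b.2 <= size alpha) && (0 < b.1 <= nth 0 alpha b.2.-1).
Proof.
case: b => j i; apply/allpairsPdep/idP => /= [[i' [j' [ii jj [-> ->]]]]|/andP[hi hj]].
  by move: ii jj; rewrite !mem_iota; lia.
by exists i, j; rewrite !mem_iota; split=> //; lia.
Qed.

Lemma le_width (b : nat * nat) : b \in tcd alpha -> b.1 <= width.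
Proof.
case: b => j i; rewrite mem_tcd /= => /andP[hi /andP[_ hj]]; apply: leq_trans hj _.
have ia : nth 0 alpha i.-1 \in alpha by case/andP: hi => i0 il; rewrite mem_nth // prednK.
exact: leq_bigmax_seq.
Qed.

Lemma mem_rb b : (b \in rb_boxes alpha) = (b \in tcd alpha).
Proof.
rewrite mem_tcd; case: b => j i.
apply/allpairsPdep/idP => /= [[i' [j' [ii jj [-> ->]]]]|/andP[hi hj]].
  by move: ii jj; rewrite mem_rev !mem_iota; lia.
by exists i, j; rewrite mem_rev !mem_iota; split=> //; lia.
Qed.

Lemma mem_col b : (b \in col_boxes alpha) = (b \in tcd alpha).
Proof. by rewrite -(perm_mem (perm_rb_col alpha)) mem_rb. Qed.

Lemma mem_rcol b : (b \in rcol_boxes) = (b \in tcd alpha).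
Proof.
apply/flattenP/idP => [[_ /mapP[j jw ->] /mapP[i]]|bt].
  rewrite mem_filter mem_iota => /andP[ji iw] ->; rewrite mem_tcd /=.
  by move: jw; rewrite mem_rev mem_iota; lia.
have := le_width bt; case: b bt => j i; rewrite mem_tcd /= => /andP[hi /andP[j0 hj]] jw.
exists [seq (j, i) | i <- iota 1 (size alpha) & j <= nth 0 alpha i.-1].
  by apply: (map_f (fun j => [seq (j, i) | i <- iota 1 (size alpha) & j <= nth 0 alpha i.-1]));
     rewrite mem_rev mem_iota add1n ltnS j0.
by apply: map_f; rewrite mem_filter mem_iota add1n ltnS hj.
Qed.

Lemma sorted_rb : sorted rb_lt (rb_boxes alpha).
Proof.
rewrite sorted_pairwise; last exact: rb_lt_trans.
apply: (pairwise_flatten_map (e := ltn)) => [|i _|i i' _ _ ii]; first exact: pairwise_iota.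
  rewrite pairwise_map; apply: sub_pairwise (pairwise_rev_iota 1 _) => a b ab.
  by rewrite /rb_lt /= eqxx ab orbT.
by apply/allrelP => _ _ /mapP[j _ ->] /mapP[j' _ ->]; rewrite /rb_lt /= [_ < _]ii.
Qed.

Lemma sorted_col : sorted col_lt (col_boxes alpha).
Proof.
apply: sorted_filter; first exact: col_lt_trans.
rewrite sorted_pairwise; last exact: col_lt_trans.
apply: (pairwise_flatten_map (e := ltn)) => [|i _|i i' _ _ ii]; first exact: pairwise_iota.
  rewrite pairwise_map; apply: sub_pairwise (pairwise_iota 1 _) => a b ab.
  by rewrite /col_lt /= eqxx orbC [_ < _]ab.
by apply/allrelP => _ _ /mapP[j _ ->] /mapP[j' _ ->]; rewrite /col_lt /= [_ < _]ii.
Qed.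

Lemma sorted_rcol : sorted rcol_lt rcol_boxes.
Proof.
rewrite sorted_pairwise; last exact: rcol_lt_trans.
apply: (pairwise_flatten_map (e := fun a b => b < a)) => [|j _|j j' _ _ jj].
- exact: pairwise_rev_iota.
- rewrite pairwise_map; apply/pairwise_filter/(sub_pairwise _ (pairwise_iota 1 _)) => a b ab.
  by rewrite /rcol_lt /= eqxx orbC [_ < _]ab.
by apply/allrelP => _ _ /mapP[i _ ->] /mapP[i' _ ->]; rewrite /rcol_lt /= jj.
Qed.

Lemma uniq_rb : uniq (rb_boxes alpha).
Proof. exact: sorted_uniq rb_lt_trans rb_lt_irr _ sorted_rb. Qed.

Lemma uniq_rcol : uniq rcol_boxes.
Proof. exact: sorted_uniq rcol_lt_trans rcol_lt_irr _ sorted_rcol. Qed.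

Lemma size_rcol : size rcol_boxes = sumn alpha.
Proof.
rewrite -size_rb_boxes; apply/perm_size/uniq_perm; rewrite ?uniq_rb ?uniq_rcol //.
by move=> b; rewrite mem_rb mem_rcol.
Qed.

Lemma index_rb p q : p \in tcd alpha -> q \in tcd alpha ->
  (index p (rb_boxes alpha) < index q (rb_boxes alpha)) = rb_lt p q.
Proof.
by move=> pt qt; apply: (index_ltn_rel rb_lt_trans rb_lt_irr sorted_rb); rewrite mem_rb.
Qed.

Lemma index_col p q : p \in tcd alpha -> q \in tcd alpha ->
  (index p (col_boxes alpha) < index q (col_boxes alpha)) = col_lt p q.
Proof.
by move=> pt qt; apply: (index_ltn_rel col_lt_trans col_lt_irr sorted_col); rewrite mem_col.
Qed.

Lemma index_rcol p q : p \in tcd alpha -> q \in tcd alpha ->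
  (index p rcol_boxes < index q rcol_boxes) = rcol_lt p q.
Proof.
by move=> pt qt; apply: (index_ltn_rel rcol_lt_trans rcol_lt_irr sorted_rcol); rewrite mem_rcol.
Qed.

Hypothesis alpha_pos : all (leq 1) alpha.

Lemma compset_rb n (i : 'I_n.-1) : sumn alpha = n ->
  (i \in compset n alpha) =
  ((nth (0, 0) (rb_boxes alpha) i).2 != (nth (0, 0) (rb_boxes alpha) i.+1).2).
Proof.
move=> an; pose t i := [seq (j, i) | j <- rev (iota 1 (nth 0 alpha i.-1))].
have sh : [seq size (t i) | i <- iota 1 (size alpha)] = alpha.
  apply: (@eq_from_nth _ 0) => [|k]; rewrite size_map size_iota // => ks.
  by rewrite (nth_map 0) ?size_iota // nth_iota // size_map size_rev size_iota add1n.
have [|a|a|//|h1 h2] := @cut_flatten _ _ (iota 1 (size alpha)) t snd (0, 0) i.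
- exact: iota_uniq.
- rewrite mem_iota add1n ltnS => /andP[a0 al]; rewrite -size_eq0 size_map size_rev size_iota.
  by rewrite -lt0n (allP alpha_pos) // mem_nth // prednK.
- by move=> _ x /mapP[j _ ->].
- by rewrite size_rb_boxes an; have := ltn_ord i; lia.
rewrite sh size_iota in h1 h2.
by apply/compsetP/idP => [/h1/eqP//|/eqP/h2].
Qed.

Lemma column_neq0 y : 0 < y <= width ->
  has (fun i => y <= nth 0 alpha i.-1) (iota 1 (size alpha)).
Proof.
case: y => // y /= yw; apply: contraLR yw => /hasPn h; rewrite -leqNgt.
apply/bigmax_leqP_seq => a aa _; have := h (index a alpha).+1.
by rewrite mem_iota add1n /= ltnS index_mem nth_index // => /(_ aa); rewrite -ltnNge ltnS.
Qed.

(** Transposition turns rows from top to bottom into columns from right to left. Each column up to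
    the width meets a longest row, so the filter in [row_comp] removes nothing. *)
Lemma row_comp_rcol : row_comp (diagX alpha) =
  [seq size [seq (j, i) | i <- iota 1 (size alpha) & j <= nth 0 alpha i.-1]
  | j <- rev (iota 1 width)].
Proof.
have w : \max_(b <- diagX alpha) b.2 = width.
  rewrite big_map /=; apply/eqP; rewrite eqn_leq; apply/andP; split.
    by apply/bigmax_leqP_seq => b bt _; exact: le_width.
  apply/bigmax_leqP_seq => a aa _.
  have ba : (a, (index a alpha).+1) \in tcd alpha.
    by rewrite mem_tcd /= nth_index // index_mem aa (allP alpha_pos a aa) leqnn.
  exact: (leq_bigmax_seq (F := fun b : nat * nat => b.1) (a, (index a alpha).+1) ba isT).
rewrite /row_comp w; set c := fun y => count _ _.
have cE y : 0 < y ->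
    c y = size [seq (y, i) | i <- iota 1 (size alpha) & y <= nth 0 alpha i.-1].
  move=> y0; rewrite /c count_map size_map size_filter count_flatten -map_comp.
  elim: (iota 1 _) => //= i s ->; congr (_ + _).
  rewrite count_map -(eq_count (a1 := pred1 y)); last by move=> j; rewrite /= eq_sym.
  by rewrite (count_uniq_mem _ (iota_uniq _ _)) mem_iota y0 add1n ltnS.
rewrite (all_filterP _); last first.
  apply/allP => _ /mapP[y yw ->]; move: yw; rewrite mem_rev mem_iota => yw.
  rewrite cE; last by case/andP: yw.
  by rewrite size_map size_filter -has_count column_neq0 // -ltnS -add1n.
by apply/eq_in_map => y; rewrite mem_rev mem_iota => /andP[y0 _]; exact: cE.
Qed.

Lemma compset_rcol n (i : 'I_n.-1) : sumn alpha = n ->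
  (i \in compset n (row_comp (diagX alpha))) =
  ((nth (0, 0) rcol_boxes i).1 != (nth (0, 0) rcol_boxes i.+1).1).
Proof.
move=> an; rewrite row_comp_rcol.
pose t j := [seq (j, i) | i <- iota 1 (size alpha) & j <= nth 0 alpha i.-1].
have [|j|j|//|h1 h2] := @cut_flatten _ _ (rev (iota 1 width)) t fst (0, 0) i.
- by rewrite rev_uniq iota_uniq.
- rewrite mem_rev mem_iota => jw; rewrite -size_eq0 -lt0n size_map size_filter -has_count.
  by rewrite column_neq0 // -ltnS -add1n.
- by move=> _ x /mapP[j' _ ->].
- by rewrite -/rcol_boxes size_rcol an; have := ltn_ord i; lia.
rewrite -(size_map (fun j => size (t j))) in h1 h2.
by apply/compsetP/idP => [/h1/eqP//|/eqP/h2].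
Qed.

End Diagram.

(** * Standard extended tableaux and the embedding of X_alpha *)

Section Extended.

Variables (n : nat) (alpha : seq nat).
Hypotheses (n_gt0 : 0 < n) (alpha_comp : is_composition n alpha).

Local Notation rb := (rb_boxes alpha).
Local Notation rcol := (rcol_boxes alpha).
Local Notation A := (compset n alpha).
Local Notation S := (compset n (row_comp (diagX alpha))).
Local Notation rho := (perm_of_word n (w_RB alpha (tabT' alpha))).
Local Notation IX := (intervalL (w0S (~: A)) rho).
Implicit Types (p q : nat * nat) (z : 'S_n) (a b : 'I_n).

Let alpha_pos : all (leq 1) alpha. Proof. by case/andP: alpha_comp. Qed.
Let alpha_sum : sumn alpha = n. Proof. by case/andP: alpha_comp => _ /eqP. Qed.
Let size_rb : size rb = n. Proof. by rewrite size_rb_boxes. Qed.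
Let size_rc : size rcol = n. Proof. by rewrite size_rcol. Qed.

Definition box a : nat * nat := nth (0, 0) rb a.

(** The default is taken only outside the diagram. *)
Definition pos p : 'I_n := insubd (Ordinal n_gt0) (index p rb).

Lemma box_tcd a : box a \in tcd alpha.
Proof. by rewrite -mem_rb /box mem_nth ?size_rb. Qed.

Lemma val_pos p : p \in tcd alpha -> pos p = index p rb :> nat.
Proof.
move=> pt; have lt : index p rb < n by rewrite -[X in _ < X]size_rb index_mem mem_rb.
by rewrite val_insubd lt.
Qed.

Lemma posK p : p \in tcd alpha -> box (pos p) = p.
Proof. by move=> pt; rewrite /box val_pos // nth_index // mem_rb. Qed.

Lemma boxK a : pos (box a) = a.
Proof.
by apply: val_inj; rewrite /= val_pos ?box_tcd // index_uniq ?uniq_rb // size_rb.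
Qed.

Lemma ltn_pos p q : p \in tcd alpha -> q \in tcd alpha -> (pos p < pos q) = rb_lt p q.
Proof. by move=> pt qt; rewrite !val_pos // index_rb. Qed.

Lemma ltn_box a b : (a < b) = rb_lt (box a) (box b).
Proof. by rewrite -ltn_pos ?box_tcd // !boxK. Qed.

Lemma rho_box a : rho a = index (box a) (col_boxes alpha) :> nat.
Proof.
have := congr1 (fun w => nth 0 w a) (w_RB_tabT' alpha_comp).
rewrite (nth_map a) ?size_enum_ord // nth_ord_enum (nth_map (0, 0)) ?size_rb //.
by case.
Qed.

Lemma ltn_rho a b : (rho a < rho b) = col_lt (box a) (box b).
Proof. by rewrite !rho_box index_col ?box_tcd. Qed.

Fact rcol_pos_inj : injective (fun k : 'I_n => pos (nth (0, 0) rcol k)).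
Proof.
have rt (k : 'I_n) : nth (0, 0) rcol k \in tcd alpha by rewrite -mem_rcol mem_nth ?size_rc.
move=> k l /(congr1 box); rewrite !posK // => /eqP.
by rewrite nth_uniq ?uniq_rcol ?size_rc // => /eqP /val_inj.
Qed.

(* Right multiplication by reread turns the right-to-left row reading of a filling
   into its column reading, rightmost column first. *)
Definition reread : 'S_n := perm rcol_pos_inj.

Lemma rereadE (k : 'I_n) : box (reread k) = nth (0, 0) rcol k.
Proof. by rewrite permE posK // -mem_rcol mem_nth ?size_rc. Qed.

Lemma rereadVE a : reread^-1%g a = index (box a) rcol :> nat.
Proof.
by rewrite -{2}[a](permKV reread) rereadE index_uniq ?uniq_rcol ?size_rc.
Qed.

Lemma ltn_rereadV a b : (reread^-1%g a < reread^-1%g b) = rcol_lt (box a) (box b).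
Proof. by rewrite !rereadVE index_rcol ?box_tcd. Qed.

(* z, read along rb_boxes, is the reading word of a standard extended tableau. *)
Definition is_SET z := forall a b, a != b ->
  (box a).1 <= (box b).1 -> (box a).2 <= (box b).2 -> z a < z b.

Lemma mem_tcd_left p j : p \in tcd alpha -> 0 < j <= p.1 -> (j, p.2) \in tcd alpha.
Proof. by rewrite !mem_tcd /=; lia. Qed.

Lemma tcd_gt0 p : p \in tcd alpha -> 0 < p.1.
Proof. by rewrite mem_tcd; lia. Qed.

Lemma box_neq a b : a != b -> box a != box b.
Proof. by apply: contra => /eqP e; rewrite -(boxK a) e boxK. Qed.

Lemma mem_compset_box (i : 'I_n.-1) : (i \in A) = ((box (lo i)).2 != (box (hi i)).2).
Proof. exact: compset_rb. Qed.

Lemma mem_row_comp_box (i : 'I_n.-1) :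
  (i \in S) = ((box (reread (lo i))).1 != (box (reread (hi i))).1).
Proof. by rewrite !rereadE; exact: compset_rcol. Qed.

Lemma row_mono a b : a <= b -> (box a).2 <= (box b).2.
Proof.
rewrite leq_eqVlt => /orP[/eqP/val_inj->//|]; rewrite ltn_box /rb_lt.
by case/orP => [/ltnW|/andP[/eqP->]].
Qed.

Lemma rcol_mono a b : a <= b -> (box (reread b)).1 <= (box (reread a)).1.
Proof.
rewrite leq_eqVlt => /orP[/eqP/val_inj->//|]; rewrite -{1}(permK reread a) -{1}(permK reread b).
by rewrite ltn_rereadV /rcol_lt; case/orP => [/ltnW|/andP[/eqP->]].
Qed.

(** The lower bound says that rows, read from right to left, decrease. The pairs that [rho] leaves
    in order are those whose first box is strictly lower and weakly to the left, so the upper bound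
    gives the remaining inequalities. *)
Lemma SET_interval z : z \in IX <-> is_SET z.
Proof.
rewrite mem_intervalL leL_w0S leLP; split.
  move=> /andP[/subsetP Az /subsetP zr] a b ab hx; rewrite leq_eqVlt => /orP[/eqP hy|hy].
    have ba : b < a.
      have := box_neq ab; case: (box a) (box b) hx hy (ltn_box b a) => [x y] [x' y'] /=.
      by move=> hx <- ->; rewrite /rb_lt xpair_eqE /=; lia.
    apply: decreasing_run => // i /andP[bi ia]; apply: Az; rewrite inE mem_compset_box negbK.
    rewrite eqn_leq row_mono //=; apply: leq_trans (row_mono (a := hi i) (b := a) ia) _.
    by rewrite hy; exact: (row_mono (a := b) (b := lo i) bi).
  have lab : a < b by rewrite ltn_box /rb_lt hy.
  have := zr (a, b); rewrite !mem_invset lab /= ltn_rho /col_lt.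
  rewrite [z a < z b]perm_ltn // => h; apply/negP => /h.
  by move: hx hy; case: (box a) (box b) => [x y] [x' y'] /=; lia.
move=> zT; apply/andP; split.
  apply/subsetP => i; rewrite inE mem_compset_box negbK mem_desR => /eqP e.
  have := ltn_box (lo i) (hi i); rewrite lo_hi_ltn /rb_lt e eqxx ltnn /= => /esym h.
  by apply: zT; rewrite ?e ?(ltnW h) // eq_sym lo_neq_hi.
apply/subsetP => -[a b]; rewrite !mem_invset => /andP[ab zba]; rewrite ab /=.
have nab : a != b by apply: contraTneq ab => ->; rewrite ltnn.
rewrite perm_ltn 1?eq_sym //; apply: contraL zba; rewrite ltn_rho => cab.
rewrite -perm_ltn //; apply: zT => //; move: cab ab; rewrite ltn_box /col_lt /rb_lt; lia.
Qed.

Lemma SET_consecutive z a b c : is_SET z -> z b = (z a).+1 :> nat -> a != c -> c != b ->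
  (box a).1 <= (box c).1 -> (box a).2 <= (box c).2 ->
  (box c).1 <= (box b).1 -> (box c).2 <= (box b).2 -> False.
Proof. by move=> zT e ac cb h1 h2 h3 h4; have := zT a c ac h1 h2; have := zT c b cb h3 h4; lia. Qed.

(** Rows are left-justified, so the box in the column of [a] and the row of [b] exists; its entry
    would lie strictly between consecutive integers. *)
Lemma SET_no_diagonal z a b : is_SET z -> z b = (z a).+1 :> nat ->
  (box a).1 < (box b).1 -> (box a).2 < (box b).2 -> False.
Proof.
move=> zT e h1 h2; have rt : ((box a).1, (box b).2) \in tcd alpha.
  by apply: mem_tcd_left (box_tcd b) _; rewrite tcd_gt0 ?box_tcd // ltnW.
apply: (SET_consecutive (c := pos ((box a).1, (box b).2)) zT e);
  rewrite ?posK //= ?(ltnW h1) ?(ltnW h2) //.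
- by apply: contraTneq h2 => ->; rewrite posK //= ltnn.
- by apply: contraTneq h1 => <-; rewrite posK //= ltnn.
Qed.

(** The box of [b] is neither weakly southwest nor strictly northeast of that of [a]. So it is
    strictly right and weakly below, or strictly above and weakly left, and the two reading orders
    agree in both cases. *)
Lemma SET_descent z a b : is_SET z -> z b = (z a).+1 :> nat ->
  rb_lt (box b) (box a) = rcol_lt (box b) (box a).
Proof.
move=> zT e; have ab : a != b by apply: contra_eqN e => /eqP->; rewrite ltn_eqF.
have nd := SET_no_diagonal zT e.
have nba : ~~ ((box b).1 <= (box a).1) || ~~ ((box b).2 <= (box a).2).
  rewrite -negb_and; apply/negP => /andP[h1 h2].
  by have := zT b a; rewrite eq_sym ab h1 h2 e => /(_ isT isT isT); rewrite ltnNge leqnSn.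
have nd' : ~~ (((box a).1 < (box b).1) && ((box a).2 < (box b).2)).
  by apply/negP => /andP[h1 h2]; exact: nd.
move: nba nd'; rewrite /rb_lt /rcol_lt; case: (box a) (box b) => [x y] [x' y'] /=; lia.
Qed.

Lemma SET_desL z : is_SET z -> desL (reread * z)%g = desL z.
Proof.
move=> zT; apply/setP => i; rewrite !mem_desL invMg !permM ltn_rereadV ltn_box.
by apply/esym/(SET_descent zT); rewrite !permKV.
Qed.

(** Entries increase up a column. When the reading moves to a column further left, the box [c] in
    the column of [b] and the row of [a] shows that the entry drops from [a] to [b]. *)
Lemma SET_desR z : is_SET z -> desR (reread * z)%g = S.
Proof.
move=> zT; apply/setP => i; rewrite mem_desR !permM mem_row_comp_box.
set a := reread (lo i); set b := reread (hi i).
have ab : rcol_lt (box a) (box b) by rewrite -ltn_rereadV !permK lo_hi_ltn.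
have nab : a != b by rewrite (inj_eq perm_inj) lo_neq_hi.
have [e|ne] := eqVneq (box a).1 (box b).1.
  apply/negbTE; rewrite -leqNgt ltnW //; apply: zT => //; first by rewrite e.
  by move: ab; rewrite /rcol_lt e ltnn eqxx /= => /ltnW.
have lba : (box b).1 < (box a).1 by move: ab ne; rewrite /rcol_lt; lia.
have rt : ((box b).1, (box a).2) \in tcd alpha.
  by apply: mem_tcd_left (box_tcd a) _; rewrite tcd_gt0 ?box_tcd // ltnW.
set c := pos ((box b).1, (box a).2); have bc : box c = ((box b).1, (box a).2) by rewrite posK.
have ca : z c < z a.
  by apply: zT; rewrite ?bc //= 1?ltnW //; apply: contraTneq lba => <-; rewrite bc ltnn.
have [-> //|cb] := eqVneq b c.
apply: leq_ltn_trans ca; apply/ltnW/zT => //; rewrite ?bc //=.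
(* As [b] comes directly after [a] in the reading, [c] is not read before [b], hence is not below
   it. *)
have : rcol_lt (box a) (box c) by rewrite bc /rcol_lt /= lba.
rewrite -ltn_rereadV permK -[_ < _]/(hi i <= _) leq_eqVlt => /orP[/eqP/val_inj e|].
  by move: cb; rewrite /b e permKV eqxx.
rewrite -{1}[hi i](permK reread) ltn_rereadV /rcol_lt bc /= ltnn eqxx /=.
exact: ltnW.
Qed.

(** Only the boxes [a] and [b] of the exchanged values could violate the order. The ascent puts [b]
    in a higher row, and [SET_no_diagonal] then puts it in the column of [a]. The reread word has no
    descent inside a column, so [a] and [b] remain in order. *)
Lemma SET_swap z (i : 'I_n.-1) : is_SET z -> i \notin desL z ->
  desR (reread * (z * sgen i))%g = S -> is_SET (z * sgen i)%g.
Proof.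
move=> zT iz zS a b ab h1 h2; rewrite !permM.
have zab := zT a b ab h1 h2.
have [[ea eb]|ne] := eqVneq (z a, z b) (lo i, hi i); last exact: sgen_ltn.
have lab : rb_lt (box a) (box b).
  by rewrite -ltn_box; move: iz; rewrite notin_desL -ea -eb !permK.
have e : z b = (z a).+1 :> nat by rewrite ea eb.
have h2' : (box a).2 < (box b).2 by move: lab h1 h2; rewrite /rb_lt; lia.
have h1' : (box a).1 = (box b).1.
  apply/eqP; rewrite eqn_leq h1 leqNgt; apply/negP => h1'; exact: SET_no_diagonal zT e h1' h2'.
have lt : reread^-1%g a < reread^-1%g b.
  by rewrite ltn_rereadV /rcol_lt h1' eqxx h2' orbT.
have := @increasing_run _ (reread * (z * sgen i))%g _ _ lt.
rewrite !permM !permKV; apply=> k /andP[ak kb]; rewrite zS mem_row_comp_box negbK.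
rewrite eqn_leq [X in _ && X]rcol_mono // andbT.
have := rcol_mono (a := reread^-1%g a) (b := lo k) ak.
have := rcol_mono (a := hi k) (b := reread^-1%g b) kb.
by rewrite !permKV h1' => l1 l2; exact: leq_trans l2 l1.
Qed.

Lemma rho_interval : rho \in IX.
Proof.
apply/SET_interval => a b ab h1 h2; rewrite ltn_rho /col_lt; have := box_neq ab.
by move: h1 h2; case: (box a) (box b) => [x y] [x' y'] /=; rewrite xpair_eqE; lia.
Qed.

Lemma Xmod_embedding (F : fieldType) :
  exists2 f : {linear Xmod F n alpha -> Bmod F (w0S S) (w1S S)},
    injective f & exists m, f m != 0%R.
Proof.
have [z /SET_interval zT|z /SET_interval zT|z i /SET_interval zT zi zS|f fI] :=
  @Bmod_embedding F n (w0S (~: A)) rho reread S.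
- exact: SET_desR.
- exact: SET_desL.
- by apply/SET_interval; exact: SET_swap.
exists f => //; exists (bv F (w0S (~: A)) rho rho); apply/eqP; rewrite -(linear0 f) => /fI.
move/(congr1 (fun v : Xmod F n alpha => bcoord v rho)); rewrite bcoord0 bcoord_bv eqxx.
by rewrite rho_interval => /eqP; rewrite oner_eq0.
Qed.

End Extended.

From mathcomp Require Import reals complex.
Theorem corollary5p10 (R : realType) (n : nat) (n_gt0 : (0 < n)%N)
    (alpha : seq nat) (alpha_comp : is_composition n alpha) :
  let S := compset n (row_comp (diagX alpha)) in
  let P := Bmod R[i] (w0S S) (w1S S) in
  [/\ injective_hull (Xmod R[i] n alpha) P, projective P & indecomposable P].
Proof.
move=> S P; split; [|exact: projective_Bmod|exact: indecomposable_Bmod].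
split; [exact: fin_gen_Bmod|exact: injective_fg_Bmod|].
have [f fI f0] := Xmod_embedding n_gt0 alpha_comp R[i].
by exists f; split=> //; exact: essential_Bmod.
Qed.
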